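(* Let $r\ge 2$, let $f\in P=\mathbb{C}[X_0,\dots,X_r]$ be a reduced homogeneous polynomial of degree $d$, and let $X=V(f)\subset\mathbb{P}^r$. Assume that the hypersurface $X$ has at most isolated singularities. Then there are isomorphisms $$H^0_{\mathbf{m}}(R(f))_k\cong H^0_{\mathbf{m}}(R(f))_{\sigma-k}^\vee,\qquad 0\le k\le\sigma,$$ where $\sigma=(r+1)(d-2)$.
   Context: $R(f)=P/J(f)$ is the jacobian ring of $f$, where $J(f)=\left(\frac{\partial f}{\partial X_0},\dots,\frac{\partial f}{\partial X_r}\right)$ is the gradient ideal. $\mathbf{m}=(X_0,\dots,X_r)$, and $H^0_{\mathbf{m}}(R(f))=J(f)^{sat}/J(f)$ is the $0$-th local cohomology module of $R(f)$ with respect to $\mathbf{m}$ ($J(f)^{sat}$ is the saturation of $J(f)$); it is a graded $P$-module, and the subscript $k$ denotes its degree $k$ part. For a vector space $V$, $V^\vee=\mathrm{Hom}_{\mathbb{C}}(V,\mathbb{C})$. *)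

(* Defs.v *)
From HB Require Import structures.
From mathcomp Require Import all_boot all_order all_algebra.
From mathcomp Require Import boolp classical_sets functions reals complex.
From mathcomp Require Import mpoly.

Set Implicit Arguments.
Unset Strict Implicit.
Unset Printing Implicit Defensive.

Import Order.TTheory GRing.Theory Num.Theory.
Local Open Scope ring_scope.
Local Open Scope classical_set_scope.
Local Open Scope quotient_scope.

Section Dual.
Variables (K : fieldType) (V : lmodType K).

Definition linear_form_pred : {pred V -> K^o} := fun l => `[< linear l >].

Lemma linear_form_closed : submod_closed linear_form_pred.
Proof.
split=> [|a l m /asboolP hl /asboolP hm]; apply/asboolP=> c u v /=.
  by rewrite scaler0 addr0.
change (a *: l (c *: u + v) + m (c *: u + v)
  = c *: (a *: l u + m u) + (a *: l v + m v)).
by rewrite hl hm !scalerDr !scalerA [c * a]mulrC addrACA.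
Qed.

HB.instance Definition _ :=
  GRing.isSubmodClosed.Build K (V -> K^o) linear_form_pred linear_form_closed.

Definition dual := {l : V -> K^o | linear_form_pred l}.

HB.instance Definition _ := SubChoice.on dual.
HB.instance Definition _ := [SubChoice_isSubLmodule of dual by <:].

End Dual.

Definition lmod_isomorphic (K : fieldType) (U V : lmodType K) : Prop :=
  exists phi : {linear U -> V}, bijective phi.

Section Ideals.
Variable A : comNzRingType.

Definition ideal_gen (S : set A) : set A :=
  [set p | exists2 s : seq (A * A),
     (forall x, x \in s -> S x.2) & p = \sum_(x <- s) x.1 * x.2].

Definition ideal_mul (I J : set A) : set A :=
  ideal_gen [set p | exists a b, [/\ I a, J b & p = a * b]].

Definition ideal_exp (I : set A) (N : nat) : set A :=
  iter N (ideal_mul I) setT.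

(* I : m^oo, the union of the colon ideals I : m^N. *)
Definition ideal_saturation (m I : set A) : set A :=
  [set p | exists N, forall q, ideal_exp m N q -> I (q * p)].

Lemma ideal_genD (S : set A) p q :
  ideal_gen S p -> ideal_gen S q -> ideal_gen S (p + q).
Proof.
move=> [s hs ->] [t ht ->]; exists (s ++ t); last by rewrite big_cat.
by move=> x; rewrite mem_cat => /orP[/hs|/ht].
Qed.

Lemma ideal_genM (S : set A) a p : ideal_gen S p -> ideal_gen S (a * p).
Proof.
move=> [s hs ->]; exists [seq (a * x.1, x.2) | x <- s].
  by move=> x /mapP[y /hs hy ->].
by rewrite big_map mulr_sumr; apply: eq_bigr => x _; rewrite mulrA.
Qed.

Lemma ideal_gen0 (S : set A) : ideal_gen S 0.
Proof. by exists [::]; rewrite ?big_nil. Qed.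

Lemma ideal_exp_closed (I : set A) N :
  [/\ ideal_exp I N 0,
      forall p q, ideal_exp I N p -> ideal_exp I N q -> ideal_exp I N (p + q)
    & forall a p, ideal_exp I N p -> ideal_exp I N (a * p)].
Proof.
case: N => [|N] //; split; [exact: ideal_gen0 | exact: ideal_genD |].
exact: ideal_genM.
Qed.

Lemma ideal_exp_anti (I : set A) N M p :
  ideal_exp I (N + M) p -> ideal_exp I M p.
Proof.
have [e0 eD eM] := ideal_exp_closed I M.
elim: N p => // N ih p; rewrite addSn => -[s hs ->].
elim: s hs => [|x s ihs] hs; first by rewrite big_nil.
rewrite big_cons; apply: eD; last first.
  by apply: ihs => y ys; apply: hs; rewrite inE ys orbT.
have [a [b [_ /ih hb ->]]] := hs x (mem_head _ _).
exact/eM/eM.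
Qed.

End Ideals.

Section JacobianRing.
Variables (K : fieldType) (n : nat).
Local Notation P := {mpoly K[n]}.

Definition irrelevant_ideal : set P := ideal_gen (range (fun i : 'I_n => 'X_i)).

Definition gradient_ideal (f : P) : set P :=
  ideal_gen (range (fun i : 'I_n => f^`M(i))).

Definition gradient_saturation (f : P) : set P :=
  ideal_saturation irrelevant_ideal (gradient_ideal f).

Lemma gradient_saturation_closed f :
  [/\ gradient_saturation f 0
    & forall a p q, gradient_saturation f p -> gradient_saturation f q ->
        gradient_saturation f (a *: p + q)].
Proof.
split; first by exists 0%N => q _; rewrite mulr0; exact: ideal_gen0.
move=> a p q [N hN] [M hM]; exists (N + M)%N => u hu.
rewrite mulrDr -scalerAr -mul_mpolyC; apply: ideal_genD.
  by apply/ideal_genM/hN; move: hu; rewrite addnC; exact: ideal_exp_anti.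
exact: hM (ideal_exp_anti hu).
Qed.

Variable f : P.

Definition gradient_pred : {pred P} := fun p => `[< gradient_ideal f p >].

Lemma gradient_pred_closed : submod_closed gradient_pred.
Proof.
split=> [|a p q /asboolP hp /asboolP hq]; apply/asboolP.
  exact: ideal_gen0.
by rewrite -mul_mpolyC; apply: ideal_genD => //; exact: ideal_genM.
Qed.

HB.instance Definition _ :=
  GRing.isSubmodClosed.Build K P gradient_pred gradient_pred_closed.

(* P / J(f) as a K-vector space. J(f) is not required to be proper (it is P when
   d = 1), so the quotient by a zmodClosed predicate is used and not the ring
   quotient by an idealr, whose instances need 1 \notin J(f). *)
Definition jacobian_ring := {ideal_quot gradient_pred}.

HB.instance Definition _ := GRing.Zmodule.on jacobian_ring.

Definition jacobian_class (p : P) : jacobian_ring := \pi_({ideal_quot gradient_pred}) p.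

Definition jacobian_scale (a : K) (x : jacobian_ring) : jacobian_ring :=
  jacobian_class (a *: repr x).

Lemma jacobian_class_eq p q :
  jacobian_class p = jacobian_class q <-> gradient_ideal f (p - q).
Proof.
rewrite /jacobian_class.
split=> [/eqP|h]; last apply/eqP; rewrite -Quotient.idealrBE.
  by move=> /asboolP.
exact/asboolP.
Qed.

Lemma jacobian_classD p q :
  jacobian_class (p + q) = jacobian_class p + jacobian_class q.
Proof. exact: (raddfD \pi_{ideal_quot gradient_pred}). Qed.

Lemma jacobian_classK x : jacobian_class (repr x) = x.
Proof. exact: reprK. Qed.

Lemma jacobian_classZ a p :
  jacobian_class (a *: p) = jacobian_scale a (jacobian_class p).
Proof.
apply/jacobian_class_eq; rewrite -scalerBr -mul_mpolyC; apply: ideal_genM.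
by apply/jacobian_class_eq; rewrite jacobian_classK.
Qed.

Lemma jacobian_scaleA a b x :
  jacobian_scale a (jacobian_scale b x) = jacobian_scale (a * b) x.
Proof. by rewrite -[x]jacobian_classK -!jacobian_classZ scalerA. Qed.

Lemma jacobian_scale1 : left_id 1 jacobian_scale.
Proof. by move=> x; rewrite -[x]jacobian_classK -jacobian_classZ scale1r. Qed.

Lemma jacobian_scaleDr : right_distributive jacobian_scale +%R.
Proof.
move=> a x y; rewrite -[x]jacobian_classK -[y]jacobian_classK.
by rewrite -jacobian_classD -!jacobian_classZ scalerDr jacobian_classD.
Qed.

Lemma jacobian_scaleDl x : {morph jacobian_scale^~ x : a b / a + b}.
Proof.
move=> a b; rewrite -[x]jacobian_classK -!jacobian_classZ.
by rewrite scalerDl jacobian_classD.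
Qed.

HB.instance Definition _ := GRing.Zmodule_isLmodule.Build K jacobian_ring
  jacobian_scaleA jacobian_scale1 jacobian_scaleDr jacobian_scaleDl.

(* J(f)^sat / J(f), as a subspace of P / J(f). *)
Definition local_cohomology0 : set jacobian_ring :=
  jacobian_class @` gradient_saturation f.

Definition jacobian_degree (k : nat) : set jacobian_ring :=
  jacobian_class @` [set p | p \is k.-homog].

Definition H0m_pred (k : nat) : {pred jacobian_ring} :=
  fun x => `[< local_cohomology0 x /\ jacobian_degree k x >].

Lemma H0m_pred_closed k : submod_closed (H0m_pred k).
Proof.
have [sat0 satZD] := gradient_saturation_closed f.
split; first apply/asboolP.
  have <- : jacobian_class 0 = 0 by exact: raddf0.
  by split; [exists 0 | exists 0 => //=; exact: rpred0].
move=> a _ _ /asboolP[[p hp <-] [p' hp' ep]] /asboolP[[q hq <-] [q' hq' eq]].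
apply/asboolP; split.
  exists (a *: p + q); first exact: satZD.
  by rewrite jacobian_classD jacobian_classZ.
exists (a *: p' + q'); first by rewrite /= rpredD ?rpredZ.
by rewrite jacobian_classD jacobian_classZ ep eq.
Qed.

HB.instance Definition _ k := GRing.isSubmodClosed.Build K jacobian_ring
  (H0m_pred k) (H0m_pred_closed k).

Definition H0m (k : nat) := {x : jacobian_ring | H0m_pred k x}.

HB.instance Definition _ k := SubChoice.on (H0m k).
HB.instance Definition _ k := [SubChoice_isSubLmodule of (H0m k) by <:].

(* f has no multiple factor; this excludes f = 0. *)
Definition reduced_poly : Prop :=
  forall g h, f = g ^+ 2 * h -> g \is a GRing.unit.

(* Points of projective space are given by nonzero homogeneous coordinates. *)
Definition singular_point (v : 'I_n -> K) : Prop :=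
  [/\ exists i, v i != 0, f.@[v] = 0 & forall i, (f^`M(i)).@[v] = 0].

(* Every singular point has a basic Zariski-open neighbourhood {g != 0} that
   contains no other singular point. *)
Definition isolated_singularities : Prop :=
  forall v, singular_point v ->
    exists (e : nat) (g : P), [/\ g \is e.-homog, g.@[v] != 0 &
      forall w, singular_point w -> g.@[w] != 0 ->
        exists c : K, forall i, w i = c * v i].

End JacobianRing.

(* An integer, negative when d < 2. *)
Definition sigma (r d : nat) : int := r.+1%:Z * (d%:Z - 2).

(* Main.v *)
From HB Require Import structures.
Require Import Defs.
From mathcomp Require Import all_boot all_order all_algebra.
From mathcomp Require Import boolp classical_sets functions cardinality.
From mathcomp Require Import reals complex mpoly ring zify.
From mathcomp Require lebesgue_measure.


(** Write P for the polynomial ring in n = r+1 variables, J for the gradient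
    ideal and e = d-1 for the degree of the partial derivatives. Isolated
    singularities mean that the partials have finitely many common zeros in
    projective space, so J contains n-1 forms of degree e that cut out a
    complete intersection of dimension one, and one more form of degree e
    completes them to generators of J. Call I the ideal of these n-1 forms and
    g the last one: J = I + (g), and A = P/I is a one-dimensional
    Gorenstein ring. The duality is then an instance of linkage.

    Let l be a linear form without zeros on the singular points. It is a
    nonzerodivisor on A, and a polynomial p belongs to the saturation of J if
    and only if l^N p = g p' holds in A for some N and some p'. Fix N large
    enough for the two degrees k and sigma-k. The ring A/(l^N) is Artinian
    Gorenstein, with one-dimensional socle in degree (n-1)(e-1) + N-1; let phi
    be a linear form on it that is supported in that degree and does not
    vanish there. If l^N p = g p' and l^N q = g q' in A, then p' q = p q'
    because l is a nonzerodivisor, and the pairing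

       (p, q) |-> phi(p' q) = phi(p q')

    depends only on p and q modulo J. Counting degrees, it pairs degree k with
    degree sigma-k. It is nondegenerate: the polynomials p' that occur are
    exactly those with g p' in I + (l^N), that is, the annihilator of g in
    A/(l^N), whose orthogonal for phi is the ideal of g; so a q that pairs to
    zero with all of them lies in J + (l^N), and in J since its degree is less
    than N ([linked_nondegenerate], [linkage_duality]).

    The Gorenstein property is obtained by exchanging generators one at a time
    ([gorenstein_exchange]). The variables form a regular sequence, and the
    quotient by them has the socle spanned by 1. If x and y are nonzerodivisors
    modulo an ideal I' and w spans the socle modulo I' + (x), then the solution
    w' of x w' = y w spans the socle modulo I' + (y) ([socle_exchange]). In
    this way linear forms are replaced by generic combinations of the partials
    ([exchange_chain]); each choice has only to avoid finitely many points
    ([finite_zeros], [generic_combination]).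

    Zeros are related to ideals by the Nullstellensatz, for which the
    uncountability of the complex numbers gives a short proof
    ([translated_variable_proper], [projective_nullstellensatz]). *)

Set Implicit Arguments.
Unset Strict Implicit.
Unset Printing Implicit Defensive.

Import Order.TTheory GRing.Theory Num.Theory.
Local Open Scope ring_scope.

(** * Graded ideals *)

Section GradedIdeals.
Variables (K : fieldType) (n : nat).
Local Notation P := {mpoly K[n]}.
Implicit Types (I : set P) (p q x y z w : P) (s t : seq P).

Definition is_ideal I : Prop :=
  [/\ I 0, forall p q, I p -> I q -> I (p + q) & forall a p, I p -> I (a * p)].

Definition graded_ideal I : Prop :=
  is_ideal I /\ forall k p, I p -> I (pihomog mdeg k p).

Definition adjoin I x : set P := [set p | exists a, I (p - a * x)].

(** The base ideal [I] is kept as a parameter because exchanging one generator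
    works modulo the ideal of all the others. *)
Definition adjoin_seq I s : set P := foldl adjoin I s.

Definition nonzerodivisor_mod I x : Prop := forall p, I (x * p) -> I p.

Fixpoint regular I s : Prop :=
  if s is x :: s' then nonzerodivisor_mod I x /\ regular (adjoin I x) s'
  else True.

Definition positive_form p : Prop := exists2 e, (0 < e)%N & p \is e.-homog.

Section IdealTheory.
Variables (I : set P) (idI : is_ideal I).

Lemma ideal0 : I 0. Proof. by case: idI. Qed.
Lemma idealD p q : I p -> I q -> I (p + q). Proof. by case: idI => _ + _; apply. Qed.
Lemma idealM a p : I p -> I (a * p). Proof. by case: idI => _ _; apply. Qed.
Lemma idealMr a p : I p -> I (p * a). Proof. by rewrite mulrC; apply: idealM. Qed.
Lemma idealN p : I p -> I (- p). Proof. by rewrite -mulN1r; apply: idealM. Qed.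
Lemma idealB p q : I p -> I q -> I (p - q).
Proof. by move=> Ip Iq; apply/idealD/idealN. Qed.
Lemma idealZ c p : I p -> I (c *: p).
Proof. by rewrite -mul_mpolyC; apply: idealM. Qed.
Lemma ideal_sum (T : eqType) (r : seq T) (Q : pred T) F :
  (forall i, i \in r -> Q i -> I (F i)) -> I (\sum_(i <- r | Q i) F i).
Proof.
move=> IF; rewrite big_seq_cond; apply: (big_ind I) => [||i /andP[ir Qi]].
- exact: ideal0.
- exact: idealD.
- exact: IF.
Qed.
Lemma ideal_congr p q : I (p - q) -> I q -> I p.
Proof. by move=> Ipq Iq; rewrite -[p](subrK q); apply: idealD. Qed.

Lemma ideal_adjoin x : is_ideal (adjoin I x).
Proof.
split=> [|p q [a Ia] [b Ib]|a p [b Ib]].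
- by exists 0; rewrite mul0r subr0; exact: ideal0.
- exists (a + b); have -> : p + q - (a + b) * x = (p - a * x) + (q - b * x) by ring.
  exact: idealD.
- exists (a * b); have -> : a * p - a * b * x = a * (p - b * x) by ring.
  exact: idealM.
Qed.

Lemma sub_adjoin x p : I p -> adjoin I x p.
Proof. by exists 0; rewrite mul0r subr0. Qed.

Lemma mem_adjoin x : adjoin I x x.
Proof. by exists 1; rewrite mul1r subrr; exact: ideal0. Qed.

End IdealTheory.

Lemma adjoinC I x y : adjoin (adjoin I x) y = adjoin (adjoin I y) x.
Proof.
apply/predeqP => p; split=> -[a [b h]]; exists b, a.
  by rewrite -[_ - _ - _]addrAC.
by rewrite -[_ - _ - _]addrAC.
Qed.

Lemma adjoin_seq_adjoin I s x :
  adjoin_seq (adjoin I x) s = adjoin (adjoin_seq I s) x.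
Proof. by elim: s I => //= y s ih I; rewrite adjoinC ih. Qed.

Lemma adjoin_seq_rcons I s x :
  adjoin_seq I (rcons s x) = adjoin (adjoin_seq I s) x.
Proof. by rewrite /adjoin_seq -cats1 foldl_cat. Qed.

Lemma ideal_adjoin_seq I s : is_ideal I -> is_ideal (adjoin_seq I s).
Proof. by elim: s I => //= x s ih I /ideal_adjoin/(_ x)/ih. Qed.

Lemma sub_adjoin_seq I s p : I p -> adjoin_seq I s p.
Proof. by elim: s I => //= x s ih I Ip; apply/ih/sub_adjoin. Qed.

Lemma mem_adjoin_seq I s x : is_ideal I -> x \in s -> adjoin_seq I s x.
Proof.
elim: s I => //= y s ih I idI; rewrite inE => /predU1P[->|xs].
  exact/sub_adjoin_seq/mem_adjoin.
by apply: ih => //; exact: ideal_adjoin.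
Qed.

Lemma adjoin_seq_min I J s p : is_ideal J -> (forall q, I q -> J q) ->
  (forall x, x \in s -> J x) -> adjoin_seq I s p -> J p.
Proof.
move=> idJ; elim: s I => [|x s ih] I IJ sJ /=; first exact: IJ.
apply: ih => [q [a /IJ Jq]|y ys]; last by apply: sJ; rewrite inE ys orbT.
by apply: (ideal_congr idJ Jq); apply: (idealM idJ); apply: sJ; rewrite mem_head.
Qed.

(** * Homogeneous components *)

Lemma pihomogMhomog k e a x : x \is e.-homog ->
  pihomog mdeg k (a * x) = if (e <= k)%N then pihomog mdeg (k - e) a * x else 0.
Proof.
move=> hx; rewrite {1}[a](@pihomog_partitionE _ _ mdeg (maxn (msize a) (k - e).+1)); last first.
  by rewrite leq_max leqnn.
rewrite mulr_suml linear_sum /=.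
have piE (d : nat) : pihomog mdeg k (pihomog mdeg d a * x) =
    if (d + e == k)%N then pihomog mdeg d a * x else 0.
  have hd : pihomog mdeg d a * x \is (d + e).-homog by apply: dhomogM => //; exact: pihomogP.
  case: eqP => [<-|/eqP ne]; first by rewrite pihomog_dE.
  by rewrite (pihomog_ne0 ne).
under eq_bigr => d _ do rewrite piE.
case: leqP => [lek|ltk]; last first.
  by rewrite big1 // => d _; rewrite ifN // neq_ltn (leq_trans ltk) ?leq_addl ?orbT.
have ltm : (k - e < maxn (msize a) (k - e).+1)%N by rewrite leq_max leqnn orbT.
rewrite (bigD1 (Ordinal ltm)) //= subnK // eqxx big1 ?addr0 // => d nd.
rewrite ifN //; apply: contraNneq nd => Ed.
by rewrite -val_eqE /= -[X in _ == (X - _)%N]Ed addnK.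
Qed.

Lemma msize_homog e (p : P) : p \is e.-homog -> (msize p <= e.+1)%N.
Proof.
move=> hp; rewrite msizeE; apply/bigmax_leqP_seq => m mp _; rewrite ltnS.
by have /= -> := dhomog_mf hp mp.
Qed.

Lemma graded_adjoin I x e :
  graded_ideal I -> x \is e.-homog -> graded_ideal (adjoin I x).
Proof.
move=> [idI grI] hx; split=> [|k p [a /(grI k)]]; first exact: ideal_adjoin.
rewrite pihomogB (pihomogMhomog _ _ hx); case: ifP => _ h.
  by exists (pihomog mdeg (k - e) a).
by exists 0; rewrite mul0r.
Qed.

Lemma graded_adjoin_seq I s : graded_ideal I ->
  (forall x, x \in s -> positive_form x) -> graded_ideal (adjoin_seq I s).
Proof.
elim: s I => //= x s ih I grI hs; apply: ih => [|y ys].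
  have [e _ hx] := hs x (mem_head _ _); exact: graded_adjoin hx.
by apply: hs; rewrite inE ys orbT.
Qed.

Lemma graded_components I p : is_ideal I ->
  (forall k, (k < msize p)%N -> I (pihomog mdeg k p)) -> I p.
Proof.
move=> idI h; rewrite [p](@pihomog_partitionE _ _ mdeg (msize p)) //.
by apply: ideal_sum => // i _ _; exact: h.
Qed.

(** Multiples of [u] have no component of degree less than [e]. *)
Lemma graded_low_degree I e u c z : graded_ideal I -> u \is e.-homog ->
  I (z - c * u) -> (msize z <= e)%N -> I z.
Proof.
move=> [idI grI] hu Iz lez; apply: graded_components => // k ltk.
have := grI k _ Iz; rewrite pihomogB (pihomogMhomog _ _ hu).
by rewrite leqNgt (leq_trans ltk lez) subr0.
Qed.

Lemma graded_adjoin_homog I x e k p : graded_ideal I -> x \is e.-homog ->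
  p \is (k + e).-homog -> adjoin I x p ->
  exists2 a, a \is k.-homog & I (p - a * x).
Proof.
move=> [idI grI] hx hp [a /(grI (k + e)%N)].
rewrite pihomogB (pihomogMhomog _ _ hx) leq_addl addnK pihomog_dE // => h.
by exists (pihomog mdeg k a); first exact: pihomogP.
Qed.

(** * Regular sequences *)

Lemma nonzerodivisorX I x N :
  nonzerodivisor_mod I x -> nonzerodivisor_mod I (x ^+ N).
Proof.
move=> nx; elim: N => [|N ih] p; first by rewrite expr0 mul1r.
by rewrite exprS -mulrA => /nx/ih.
Qed.

(** Graded Nakayama: if [y * z] is in [I], then regularity shows by induction
    that [z] is divisible modulo [I] by every power of [x], and the degree of a
    high power of [x] exceeds that of [z]. *)
Lemma regular_swap I x y : graded_ideal I -> positive_form x ->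
  nonzerodivisor_mod I x -> nonzerodivisor_mod (adjoin I x) y ->
  nonzerodivisor_mod I y /\ nonzerodivisor_mod (adjoin I y) x.
Proof.
move=> grI [e e0 hx] nx ny; have idI := grI.1.
have nIy : nonzerodivisor_mod I y.
  move=> z Iyz.
  have divz N : exists c, I (z - c * x ^+ N).
    elim: N => [|N [c Ic]]; first by exists z; rewrite mulr1 subrr; exact: ideal0.
    have /ny[a Ia] : adjoin I x (y * c).
      apply: sub_adjoin; apply: (nonzerodivisorX (N := N) nx).
      have -> : x ^+ N * (y * c) = y * z - y * (z - c * x ^+ N) by ring.
      by apply: idealB => //; exact: idealM.
    exists a; have -> : z - a * x ^+ N.+1 = (z - c * x ^+ N) + x ^+ N * (c - a * x).
      by rewrite exprS; ring.
    by apply: idealD => //; exact: idealM.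
  have [c Ic] := divz (msize z).
  apply: graded_low_degree grI (dhomogMn (msize z) hx) Ic _.
  by rewrite leq_pmull.
split=> // z [b Ib].
have /ny[c Ic] : adjoin I x (y * b).
  exists z; have -> : y * b - z * x = - (x * z - b * y) by ring.
  exact: idealN.
exists c; apply: nx.
have -> : x * (z - c * y) = (x * z - b * y) + y * (b - c * x) by ring.
by apply: idealD => //; exact: idealM.
Qed.

Lemma regular_rot I x s : graded_ideal I ->
  (forall y, y \in x :: s -> positive_form y) ->
  regular I (x :: s) -> regular I (rcons s x).
Proof.
elim: s I => //= y s ih I grI hs [nx [ny rs]].
have hx : positive_form x by apply: hs; rewrite !inE eqxx.
have hy : positive_form y by apply: hs; rewrite !inE eqxx orbT.
have [nIy nyx] := regular_swap grI hx nx ny.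
split=> //; apply: ih => [|z zs|].
- by case: hy => e _ hy; exact: graded_adjoin hy.
- by apply: hs; move: zs; rewrite !inE orbCA => ->; rewrite orbT.
- by split; rewrite // adjoinC.
Qed.

Lemma regular_rcons I s x :
  regular I (rcons s x) <-> regular I s /\ nonzerodivisor_mod (adjoin_seq I s) x.
Proof.
elim: s I => [|y s ih] I /=; first by split=> [[]|[]].
by rewrite ih; split=> [[? []]|[[]]].
Qed.

(** * Parameters and socles *)

(** For a homogeneous ideal over an algebraically closed field this says that the
    ideal has no zeros besides the origin. *)
Definition irrelevant_primary I : Prop :=
  exists N, forall m : 'X_{1..n}, (N <= mdeg m)%N -> I 'X_[m].

Lemma primary_form_pow I x : is_ideal I -> irrelevant_primary I ->
  positive_form x -> exists N, I (x ^+ N).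
Proof.
move=> idI [N hN] [e e0 hx]; exists N; rewrite [_ ^+ N]mpolyE.
apply: ideal_sum => // m mx _; apply: (idealZ idI); apply: hN.
by have /= -> := dhomog_mf (dhomogMn N hx) mx; rewrite leq_pmull.
Qed.

Lemma primary_variables I : is_ideal I ->
  (forall i, exists N, I ('X_i ^+ N)) -> irrelevant_primary I.
Proof.
move=> idI /choice[N hN]; exists (\sum_i N i).+1 => m lem.
have [i lei] : exists i, (N i <= m i)%N.
  apply/existsP; apply: contraLR lem; rewrite negb_exists -ltnNge ltnS => /forallP h.
  by rewrite mdegE; apply: leq_sum => i _; rewrite ltnW // ltnNge.
have -> : m = (U_(i) *+ N i + (m - U_(i) *+ N i))%MM.
  rewrite addmC submK //; apply/mnm_lepP => j; rewrite mulmnE mnm1E.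
  by case: eqP => [<-|]; rewrite ?mul1n.
by rewrite mpolyXD; apply: idealMr => //; rewrite -mpolyXn.
Qed.

Lemma ideal_positive_form I x w : is_ideal I -> positive_form x ->
  (forall i, I ('X_i * w)) -> I (x * w).
Proof.
move=> idI [e e0 hx] h; rewrite [x]mpolyE mulr_suml.
apply: ideal_sum => // m mx _; rewrite -scalerAl; apply: idealZ => //.
have : mdeg m != 0%N by have /= -> := dhomog_mf hx mx; rewrite -lt0n.
rewrite mdegE sum_nat_eq0 negb_forall => /existsP[i /= mi].
have -> : m = (U_(i) + (m - U_(i)))%MM by rewrite addmC submK // lep1mP.
by rewrite mpolyXD mulrAC mulrC; apply: idealM.
Qed.

(** A power of [x] is a multiple of [y] modulo [I], so what [y] annihilates is
    annihilated by a power of [x]. *)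
Lemma nonzerodivisor_exchange I x y : graded_ideal I -> positive_form x ->
  irrelevant_primary (adjoin I y) ->
  nonzerodivisor_mod I x -> nonzerodivisor_mod I y.
Proof.
move=> [idI _] hx pr nx z Iyz.
have [N [c Ic]] := primary_form_pow (ideal_adjoin idI y) pr hx.
apply: (nonzerodivisorX (N := N) nx).
have -> : x ^+ N * z = z * (x ^+ N - c * y) + c * (y * z) by ring.
by apply: idealD => //; exact: idealM.
Qed.

(** The socle of the quotient by [I] is the line spanned by [w]; when [I] is
    primary to the irrelevant ideal, the quotient is thus Artinian Gorenstein. *)
Definition socle_line I d w : Prop :=
  [/\ w \is d.-homog, ~ I w, forall i, I ('X_i * w)
    & forall z, (forall i, I ('X_i * z)) -> exists c : K, I (z - c *: w)].

(** The socles modulo [x] and modulo [y] correspond to each other by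
    [x * w' = y * w] modulo [I]. Indeed [x * z] annihilates the irrelevant ideal
    modulo [x * y] if and only if [z] does modulo [y], and symmetrically. *)
Lemma socle_exchange I x y e e' d w : graded_ideal I ->
  (0 < e)%N -> (0 < e')%N -> (e <= d + e')%N ->
  x \is e.-homog -> y \is e'.-homog ->
  nonzerodivisor_mod I x -> nonzerodivisor_mod I y ->
  socle_line (adjoin I x) d w ->
  exists w', socle_line (adjoin I y) (d + e' - e) w'.
Proof.
move=> grI e0 e0' lee hx hy nx ny [hw nw mw sw]; have idI := grI.1.
have idx := ideal_adjoin idI x.
have [w' hw' Iw'] : exists2 w', w' \is (d + e' - e).-homog & I (y * w - w' * x).
  apply: graded_adjoin_homog hx _ _ => //.
    by rewrite subnK // addnC; apply: dhomogM.
  by apply: ideal_positive_form mw => //; exists e'.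
exists w'; split=> // [[c Ic]|i|z mz].
- apply: nw; exists c; apply: ny.
  have -> : y * (w - c * x) = (y * w - w' * x) + x * (w' - c * y) by ring.
  by apply: idealD => //; exact: idealM.
- have [c Ic] := mw i; exists c; apply: nx.
  have -> : x * ('X_i * w' - c * y) =
      y * ('X_i * w - c * x) - 'X_i * (y * w - w' * x) by ring.
  by apply: idealB => //; exact: idealM.
- have [t It] : adjoin I y (x * z).
    by apply: ideal_positive_form mz; [exact: ideal_adjoin | exists e].
  have [i|c [u Iu]] := sw t.
    have [c Ic] := mz i; exists c; apply: ny.
    have -> : y * ('X_i * t - c * x) =
        x * ('X_i * z - c * y) - 'X_i * (x * z - t * y) by ring.
    by apply: idealB => //; exact: idealM.
  exists c, u; apply: nx.
  have -> : x * (z - c *: w' - u * y) =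
     (x * z - t * y) + y * (t - c *: w - u * x) + c *: (y * w - w' * x).
    by rewrite -!mul_mpolyC; ring.
  by apply: idealD => //; [apply: idealD => //; exact: idealM | exact: idealZ].
Qed.

End GradedIdeals.

(** * Finite-dimensional linear algebra *)

Section RowSpaces.
Variable K : fieldType.

Definition subspace (V : lmodType K) (S : set V) : Prop :=
  S 0 /\ forall c u v, S u -> S v -> S (c *: u + v).

(** A matrix of maximal rank with rows in [S] has [S] as its row space. *)
Lemma subspace_row_space m (S : set 'rV[K]_m) : subspace S ->
  exists A : 'M[K]_m, forall u, S u <-> (u <= A)%MS.
Proof.
move=> [S0 SZD].
pose Q k := `[< exists A : 'M[K]_m, (forall u : 'rV_m, (u <= A)%MS -> S u) /\ \rank A = k >].
have exQ : exists k, Q k.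
  exists 0%N; apply/asboolP; exists 0; split; last by rewrite mxrank0.
  by move=> u; rewrite submx0 => /eqP ->.
have ubQ k : Q k -> (k <= m)%N by move=> /asboolP[A [_ <-]]; exact: rank_leq_row.
case: (ex_maxnP exQ ubQ) => k /asboolP[A [AS <-]] maxA; exists A => u; split; last exact: AS.
move=> Su; apply: contraT => nuA.
have ltA : (A < A + u)%MS.
  rewrite ltmxE addsmxSl /=; apply: contra nuA; apply: submx_trans; exact: addsmxSr.
suff /maxA : Q (\rank (A + u)%MS) by rewrite leqNgt; move: ltA; rewrite ltmxErank => /andP[_ ->].
apply/asboolP; exists (A + u)%MS; split=> // v /sub_addsmxP[[x y] /= ->].
have [c ->] : exists c, y *m u = c *: u.
  by exists (y 0 0); rewrite [y]mx11_scalar mul_scalar_mx mxE eqxx mulr1n.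
by rewrite addrC; apply: SZD => //; apply: AS; exact: submxMl.
Qed.

(** A vector outside a subspace of a coordinate space is separated from it by a
    linear form. The map [ev] carries this to a space [V] on which only finitely
    many linear forms are in use. *)
Lemma row_separation (V : lmodType K) m (ev : {linear V -> 'rV[K]_m}) (S : set V) v :
  subspace S ->
  (forall c : 'cV[K]_m, (forall s, S s -> ev s *m c = 0) -> ev v *m c = 0) ->
  exists2 s, S s & ev s = ev v.
Proof.
move=> [S0 SZD] hv.
have [|A hA] := @subspace_row_space m (ev @` S).
  split; first by exists 0; rewrite ?linear0.
  by move=> c _ _ [x Sx <-] [y Sy <-]; exists (c *: x + y); rewrite ?linearP //; exact: SZD.
suff /hA[s Ss <-] : (ev v <= A)%MS by exists s.
rewrite submxE; apply/eqP/matrixP => i j; rewrite (ord1 i) [X in _ = X]mxE.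
have colA (u : 'rV_m) : (u *m cokermx A) 0 j = (u *m col j (cokermx A)) 0 0.
  by rewrite colE mulmxA -colE [X in _ = X]mxE.
rewrite colA hv ?mxE // => s Ss; apply/matrixP => k l; rewrite !ord1 -colA [X in _ = X]mxE.
have /eqP-> : ev s *m cokermx A == 0 by rewrite -submxE; apply/hA; exists s.
by rewrite mxE.
Qed.

Lemma subspace_span (V : lmodType K) m (a : 'I_m -> V) (S : set V) :
  subspace S -> (forall v, S v -> exists c : 'I_m -> K, v = \sum_i c i *: a i) ->
  exists b : 'I_m -> V, (forall i, S (b i)) /\
    forall v, S v -> exists c : 'I_m -> K, v = \sum_i c i *: b i.
Proof.
move=> [S0 SZD] aS; pose comb (u : 'rV[K]_m) := \sum_i u 0 i *: a i.
have combP : linear comb.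
  move=> c u v; rewrite scaler_sumr -big_split; apply: eq_bigr => i _.
  by rewrite !mxE scalerDl scalerA.
have [|A hA] := @subspace_row_space m [set u | S (comb u)].
  split=> [|c u v /= Su Sv]; last by rewrite /= combP; exact: SZD.
  by rewrite /= /comb big1 // => i _; rewrite mxE scale0r.
exists (fun i => comb (row i A)); split=> [i|v Sv]; first by apply/hA; exact: row_sub.
have [c def_v] := aS v Sv.
have /submxP[x def_c] : (\row_i c i <= A)%MS.
  by apply/hA; rewrite /= /comb; under eq_bigr do rewrite mxE; rewrite -def_v.
exists (fun i => x 0 i); rewrite def_v.
have c_sum i : c i = \sum_k x 0 k * A k i by have := congr1 (fun u : 'rV_m => u 0 i) def_c; rewrite !mxE.
under eq_bigr => i _ do rewrite c_sum.
transitivity (\sum_i \sum_k x 0 k *: (A k i *: a i)).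
  apply: eq_bigr => i _; rewrite scaler_suml.
  by apply: eq_bigr => k _; rewrite scalerA.
rewrite exchange_big; apply: eq_bigr => k _; rewrite -scaler_sumr.
by congr (_ *: _); apply: eq_bigr => i _; rewrite mxE.
Qed.

End RowSpaces.

Section BoundedDegree.
Variables (K : fieldType) (n : nat).
Local Notation P := {mpoly K[n]}.

Lemma bounded_degree_dependent M D (q : 'I_D -> P) :
  (forall j, msize (q j) <= M)%N -> (#|{: 'X_{1..n < M}}| < D)%N ->
  exists2 a : 'rV[K]_D, a != 0 & \sum_j a 0 j *: q j = 0.
Proof.
move=> hq ltD.
pose A : 'M[K]_(D, #|{: 'X_{1..n < M}}|) := \matrix_(j, k) (q j)@_(enum_val k : 'X_{1..n < M}).
have : kermx A != 0.
  rewrite -mxrank_eq0 mxrank_ker -lt0n subn_gt0; exact: leq_ltn_trans (rank_leq_col _) ltD.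
case/rowV0Pn=> a /sub_kermxP aA a0; exists a => //.
apply/mpolyP => m; rewrite mcoeff0 raddf_sum /=.
have [ltm|lem] := ltnP (mdeg m) M; last first.
  rewrite big1 // => j _; rewrite mcoeffZ memN_msupp_eq0 ?mulr0 //.
  exact/msize_mdeg_ge/(leq_trans (hq j)).
have /rowP/(_ (enum_rank (BMultinom ltm))) := aA; rewrite !mxE; apply: etrans.
apply: eq_bigr => j _; by rewrite !mxE enum_rankK mcoeffZ.
Qed.

End BoundedDegree.

(** * The Nullstellensatz over an uncountable field *)

Section Substitution.
Variables (K : fieldType) (n : nat).
Local Notation P := {mpoly K[n]}.

(** Both sides are ring morphisms that agree on constants and, modulo [I], on
    variables. *)
Lemma substitution_congr (I : set P) (theta : {rmorphism P -> P}) : is_ideal I ->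
  (forall c, theta c%:MP = c%:MP) -> (forall i, I ('X_i - theta 'X_i)) ->
  forall p, I (p - theta p).
Proof.
move=> idI thetaC thetaX p; rewrite [p]mpolyE rmorph_sum -sumrB.
apply: ideal_sum => // m _ _; rewrite -mul_mpolyC rmorphM /= thetaC -mulrBr.
apply: idealM => //; rewrite mpolyXE_id rmorph_prod /=.
elim/big_ind2: _ => [|x y z t Ixy Izt|i _].
- by rewrite subrr; exact: ideal0.
- have -> : y * t - x * z = t * (y - x) + x * (t - z) by ring.
  by apply: idealD => //; exact: idealM.
- rewrite rmorphXn; elim: (m i) => [|k ih]; first by rewrite subrr; exact: ideal0.
  rewrite !exprS; set u := 'X_i ^+ k in ih *; set v := _ ^+ k in ih *.
  have -> : 'X_i * u - theta 'X_i * v = u * ('X_i - theta 'X_i) + theta 'X_i * (u - v).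
    by ring.
  by apply: idealD => //; exact: idealM.
Qed.

Lemma evaluation_congr (I : set P) (v : 'I_n -> K) : is_ideal I ->
  (forall i, I ('X_i - (v i)%:MP)) -> forall p, I (p - p.@[v]%:MP).
Proof.
move=> idI Iv; pose theta : {rmorphism P -> P} := @mpolyC n K \o meval v.
apply: (substitution_congr (theta := theta)) => // [c|i] /=; first by rewrite mevalC.
by rewrite mevalXU.
Qed.

End Substitution.

Section Nullstellensatz.
Variables (K : closedFieldType) (n : nat).
Local Notation P := {mpoly K[n]}.

(** Uncountability, in the form needed: a countable filtration of the field has an
    infinite member. *)
Definition uncountable_field : Prop :=
  forall h : K -> nat, exists M, ~ finite_set [set c : K | (h c <= M)%N]%classic.

Hypothesis uncK : uncountable_field.

(** Otherwise each ['X_i - c] has an inverse [u c] modulo [I]. Uncountably many [c]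
    and countably many degrees give infinitely many inverses of bounded degree,
    hence a linear relation between some of them. Clearing denominators turns
    it into a nonzero polynomial in ['X_i] that lies in [I]; it is a product of
    factors ['X_i - c], all invertible modulo [I]. *)
Lemma translated_variable_proper (I : set P) i : is_ideal I -> ~ I 1 ->
  exists c, ~ adjoin I ('X_i - c%:MP) 1.
Proof.
move=> idI nI1; apply/not_existsP => inv; apply: nI1.
have {inv}/choice[u hu] : forall c, exists u, I (1 - u * ('X_i - c%:MP)).
  by move=> c; exact: contrapT (inv c).
have nzd c p : I (('X_i - c%:MP) * p) -> I p.
  move=> Ip; have -> : p = p * (1 - u c * ('X_i - c%:MP)) + u c * (('X_i - c%:MP) * p).
    by ring.
  by apply: idealD => //; exact: idealM.
have [M infM] := uncK (fun c => msize (u c)).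
pose D := #|{: 'X_{1..n < M}}|.+1.
have [cs [cs_uniq cs_size csM]] : exists cs : seq K,
    [/\ uniq cs, size cs = D & forall c, c \in cs -> (msize (u c) <= M)%N].
  elim: D => [|D [cs [us ss hs]]]; first by exists [::].
  have [c [cM cs']] : exists c, (msize (u c) <= M)%N /\ c \notin cs.
    apply: contrapT => /forallNP h; apply: infM.
    apply: (sub_finite_set _ (finite_seq cs)) => c /= cM.
    by apply: contraT => cs'; case: (h c).
  exists (c :: cs); split; rewrite /= ?cs' ?ss // => x.
  by rewrite inE => /predU1P[->|/hs].
pose pt (j : 'I_D) := cs`_j.
have pt_in j : pt j \in cs by rewrite mem_nth ?cs_size.
have pt_inj j k : (pt j == pt k) = (j == k) by rewrite nth_uniq ?cs_size.
have [|a a0 rel] := @bounded_degree_dependent _ _ M D (fun j => u (pt j)) _ (leqnn _).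
  by move=> j; exact/csM.
pose psi : {rmorphism {poly K} -> P} := horner_eval ('X_i : P) \o map_poly (@mpolyC n K).
have psiX c : psi ('X - c%:P) = 'X_i - c%:MP.
  by rewrite /= rmorphB /= map_polyX map_polyC /horner_eval hornerXsubC.
have psiZ c p : psi (c *: p) = c *: psi p.
  by rewrite /= map_polyZ /horner_eval hornerZ mul_mpolyC.
(* Multiplying the relation by [Q] gives [F], nonzero by its values at [pt j]. *)
pose q j := \prod_(k < D | k != j) ('X - (pt k)%:P).
pose Q := \prod_(k < D) ('X - (pt k)%:P).
pose F := \sum_j a 0 j *: q j.
have F0 : F != 0.
  have [j aj] : exists j, a 0 j != 0 by apply/rV0Pn.
  apply: contraNneq aj => F0; have := congr1 (horner^~ (pt j)) F0.
  rewrite horner0 /F horner_sum (bigD1 j) //= big1 ?addr0 => [|k nk]; last first.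
    by rewrite hornerZ horner_prod (bigD1 j) 1?eq_sym //= hornerXsubC subrr mul0r mulr0.
  rewrite hornerZ => /eqP; rewrite mulf_eq0 => /orP[//|].
  rewrite horner_prod => /prodf_eq0[k nk]; rewrite hornerXsubC subr_eq0 pt_inj.
  by rewrite eq_sym (negPf nk).
have IF : I (psi F).
  have -> : psi F = \sum_j a 0 j *: (psi (q j) * (1 - u (pt j) * ('X_i - (pt j)%:MP))).
    have : psi Q * (\sum_j a 0 j *: u (pt j)) = 0 by rewrite rel mulr0.
    rewrite mulr_sumr => Qrel; rewrite -[psi F]subr0 -[X in _ - X]Qrel rmorph_sum -sumrB.
    apply: eq_bigr => j _; rewrite psiZ -scalerAr -scalerBr; congr (_ *: _).
    by rewrite /Q (bigD1 j) // rmorphM psiX -/(q j); ring.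
  by apply: ideal_sum => // j _ _; apply: idealZ => //; apply: idealM.
have [r def_F] := closed_field_poly_normal F.
have : I (psi (\prod_(z <- r) ('X - z%:P))).
  have -> : \prod_(z <- r) ('X - z%:P) = (lead_coef F)^-1 *: F.
    by rewrite [X in _ *: X]def_F scalerA mulVf ?lead_coef_eq0 // scale1r.
  by rewrite psiZ; exact: idealZ.
elim: r {def_F} => [|z r ih]; first by rewrite big_nil rmorph1.
by rewrite big_cons rmorphM psiX => /nzd/ih.
Qed.

(** Adding one ['X_i - v i] for each variable keeps the ideal proper, and modulo
    the result every polynomial is its value at [v]. *)
Lemma weak_nullstellensatz (I : set P) : is_ideal I -> ~ I 1 ->
  exists v, forall p, I p -> p.@[v] = 0.
Proof.
move=> idI nI1.
have max_s (s : seq 'I_n) : exists J : set P, [/\ is_ideal J, ~ J 1,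
    forall p, I p -> J p & forall i, i \in s -> exists c, J ('X_i - c%:MP)].
  elim: s => [|i s [J [idJ nJ1 IJ hs]]]; first by exists I.
  have [c nJc] := translated_variable_proper i idJ nJ1.
  exists (adjoin J ('X_i - c%:MP)); split=> // [|p Ip|j].
  - exact: ideal_adjoin.
  - exact/sub_adjoin/IJ.
  - rewrite inE => /predU1P[->|/hs[c' Jc']]; first by exists c; exact: mem_adjoin.
    by exists c'; exact: sub_adjoin.
have [J [idJ nJ1 IJ hJ]] := max_s (enum 'I_n).
have /choice[v hv] : forall i, exists c, J ('X_i - c%:MP).
  by move=> i; apply: hJ; rewrite mem_enum.
exists v => p /IJ Jp; apply: contra_notP nJ1 => /eqP pv0.
have Jpv := evaluation_congr idJ hv p.
have -> : 1 = (p.@[v])^-1%:MP * (p - (p - p.@[v]%:MP)).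
  by rewrite opprB addrC subrK -mpolyCM mulVf.
by apply: idealM => //; exact: idealB.
Qed.

Lemma pihomog_msize k (p : P) : (msize p <= k)%N -> pihomog mdeg k p = 0.
Proof.
move=> lek; rewrite pihomogE big_seq_cond big1 // => m /andP[/msize_mdeg_lt ltm /eqP /= E].
by move: ltm; rewrite ltnNge E lek.
Qed.

(** There is no zero in the affine chart where the [i]-th coordinate is 1, so
    ['X_i - 1] has an inverse [- b] modulo [I]. Comparing components, that of [b]
    in degree [k] is [- 'X_i ^+ k] modulo [I], and it vanishes for large [k]. *)
Lemma projective_nullstellensatz (I : set P) : graded_ideal I ->
  (forall v, (forall p, I p -> p.@[v] = 0) -> forall i, v i = 0) ->
  irrelevant_primary I.
Proof.
move=> grI noz; have [idI hI] := grI; apply: primary_variables => // i.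
have [[b Ib]|nJ1] := pselect (adjoin I ('X_i - 1) 1); last first.
  have [v hv] := weak_nullstellensatz (ideal_adjoin idI _) nJ1.
  have v0 : v i = 0 by apply: noz => p Ip; apply/hv/sub_adjoin.
  have := hv _ (mem_adjoin idI _).
  rewrite mevalB mevalXU meval1 v0 sub0r => /eqP; by rewrite oppr_eq0 oner_eq0.
have hX : 'X_i \is [in K[n], 1.-homog] by rewrite dhomogX; apply/eqP; exact: mdeg1.
have comp k : I ('X_i ^+ k + pihomog mdeg k b).
  have {}Ib : I (1 - b * 'X_i + b) by rewrite mulrBr mulr1 opprB addrCA addrC in Ib *.
  elim: k => [|k ih]; have := hI _ _ Ib.
    move=> /(_ 0%N); rewrite pihomogD pihomogB (pihomogMhomog _ _ hX) /=.
    by rewrite pihomog_dE ?dhomog1 // subr0.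
  move=> /(_ k.+1); rewrite pihomogD pihomogB (pihomogMhomog _ _ hX) subn1 /=.
  rewrite (pihomog_ne0 (d := 0)) ?dhomog1 // sub0r => Ik.
  have -> : 'X_i ^+ k.+1 + pihomog mdeg k.+1 b = 'X_i * ('X_i ^+ k + pihomog mdeg k b)
     + (- (pihomog mdeg k b * 'X_i) + pihomog mdeg k.+1 b) by rewrite exprS; ring.
  by apply: idealD => //; exact: idealM.
exists (msize b); have := comp (msize b); by rewrite pihomog_msize ?addr0.
Qed.

End Nullstellensatz.

(** * Finite sets of projective points *)

Section FinitePoints.
Variables (K : closedFieldType) (n : nat).
Local Notation P := {mpoly K[n]}.
Local Notation point := ('I_n -> K).
Implicit Types (Z : point -> Prop) (I : set P).

Definition nonzero_point (v : point) : Prop := exists i, v i != 0.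

Definition zero_of I (v : point) : Prop := forall p, I p -> p.@[v] = 0.

(** Finiteness in projective space, for sets of coordinate vectors. *)
Definition finitely_many_lines Z : Prop :=
  exists vs : seq {ffun 'I_n -> K}, forall v, Z v ->
    exists2 c, c != 0 & [ffun i => c * v i] \in vs.

Lemma meval_homog e (p : P) c v : p \is e.-homog ->
  p.@[fun i => c * v i] = c ^+ e * p.@[v].
Proof.
move=> hp; rewrite !mevalE mulr_sumr; apply: eq_big_seq => m mp.
under eq_bigr do rewrite exprMn; rewrite big_split /= mulrCA; congr (_ * (_ * _)).
by rewrite -expr_sum -mdegE; have /= -> := dhomog_mf hp mp.
Qed.

(** The combination of [hs] with coefficients [1, t, t ^ 2, ...]. Its values are
    those of a one-variable polynomial in [t], so it can be made nonzero at
    finitely many points at once; its first coefficient is 1, so it can replace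
    the first element of [hs] as a generator of the ideal. *)
Definition horner_comb (t : K) (hs : seq P) : P :=
  foldr (fun h g => h + t *: g) 0 hs.

Lemma horner_comb_homog e t hs :
  (forall h, h \in hs -> h \is e.-homog) -> horner_comb t hs \is e.-homog.
Proof.
elim: hs => [|h hs ih] hh /=; first exact: rpred0.
apply: rpredD; first by apply: hh; rewrite mem_head.
by apply/rpredZ/ih => g gs; apply: hh; rewrite inE gs orbT.
Qed.

Lemma meval_horner_comb t hs v :
  (horner_comb t hs).@[v] = (Poly [seq h.@[v] | h <- hs]).[t].
Proof.
rewrite horner_Poly; elim: hs => [|h hs ih] /=; first by rewrite meval0.
by rewrite mevalD mevalZ ih addrC mulrC.
Qed.

(** At each of the finitely many points the polynomial in [t] is nonzero; [t] is
    chosen outside the roots of their product. *)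
Lemma generic_combination Z e hs : finitely_many_lines Z ->
  (forall h, h \in hs -> h \is e.-homog) ->
  (forall v, Z v -> exists2 h, h \in hs & h.@[v] != 0) ->
  exists t, forall v, Z v -> (horner_comb t hs).@[v] != 0.
Proof.
move=> [vs hvs] hh hZ.
pose F (v : {ffun 'I_n -> K}) := Poly [seq h.@[v] | h <- hs].
have /closed_nonrootP[t] : \prod_(v <- vs | F v != 0) F v != 0.
  by rewrite prodf_seq_neq0; apply/allP => v _; apply/implyP.
rewrite /root horner_prod prodf_seq_neq0 => /allP ht; exists t => v Zv.
have [c c0 cv] := hvs v Zv.
have evalc g : g \is e.-homog -> g.@[[ffun i => c * v i]] = c ^+ e * g.@[v].
  by move=> hg; rewrite -(meval_homog c v hg); apply: meval_eq => i; rewrite ffunE.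
have [h hhs hv] := hZ v Zv.
suff /(implyP (ht _ cv)) : F [ffun i => c * v i] != 0.
  by rewrite -meval_horner_comb evalc ?mulf_eq0 ?negb_or; [case/andP | exact: horner_comb_homog].
apply: contraNneq hv => F0.
have := congr1 (fun q : {poly K} => q`_(index h hs)) F0.
rewrite coef0 coef_Poly (nth_map 0) ?index_mem // nth_index // evalc ?hh // => /eqP.
by rewrite mulf_eq0 expf_eq0 (negPf c0) andbF.
Qed.

(** A graded ring that becomes finite dimensional modulo a linear form [l] is
    finite over the polynomials in [l], so its projective zeros are finite in
    number: setting [l = 1], each coordinate satisfies a polynomial equation. *)
Lemma finite_zeros I l : graded_ideal I -> l \is 1.-homog ->
  irrelevant_primary (adjoin I l) ->
  finitely_many_lines (fun v => nonzero_point v /\ zero_of I v).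
Proof.
move=> grI hl [M hM]; have [idI hI] := grI.
(* Setting [l = 1] lowers degrees, so modulo [J] degree at most [M] suffices. *)
pose J := adjoin I (l - 1); have idJ : is_ideal J := ideal_adjoin idI _.
have reduce k p : p \is k.-homog -> exists2 q, (msize q <= M.+1)%N & J (p - q).
  elim: k p => [|k ih] p hp.
    by exists p; rewrite ?(leq_trans (msize_homog hp)) ?subrr //; exact: ideal0.
  have [ltkM|leMk] := ltnP k.+1 M.+1.
    by exists p; rewrite ?(leq_trans (msize_homog hp)) ?subrr //; exact: ideal0.
  have [||q hq Iq] := graded_adjoin_homog (k := k) grI hl (p := p).
  - by rewrite addn1.
  - rewrite [p]mpolyE; apply: ideal_sum; first exact: ideal_adjoin.
    move=> m mp _; apply: idealZ; first exact: ideal_adjoin.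
    by apply: hM; have /= -> := dhomog_mf hp mp; exact: ltnW.
  - have [r hr Jr] := ih q hq; exists r => //.
    have -> : p - r = (q - r) + q * (l - 1) + (p - q * l) by ring.
    apply: idealD => //; last exact: sub_adjoin.
    by apply: idealD => //; apply: idealM => //; exact: mem_adjoin.
have equation i : exists2 F : {poly K}, F != 0 &
    forall v, zero_of J v -> F.[v i] = 0.
  have hX k : exists q, (msize q <= M.+1)%N /\ J ('X_i ^+ k - q).
    have [|q] := reduce k ('X_i ^+ k); last by exists q.
    rewrite -[k in k.-homog]mul1n; apply: dhomogMn.
    by rewrite dhomogX; apply/eqP; exact: mdeg1.
  have [q hq] := choice hX.
  pose D := #|{: 'X_{1..n < M.+1}}|.+1.
  have [|a a0 rel] := bounded_degree_dependent (D := D) (q := q) _ (leqnn _).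
    by move=> j; have [] := hq j.
  exists (rVpoly a); first by apply: contraNneq a0 => ra0; rewrite -(rVpolyK a) ra0 linear0.
  move=> v Jv; rewrite (horner_coef_wide _ (size_poly _ _)).
  have /(congr1 (meval v)) := rel; rewrite meval0 rmorph_sum; apply: etrans.
  apply: eq_bigr => j _; rewrite coef_rVpoly_ord /= mevalZ; congr (_ * _).
  have [_ /Jv] := hq j; rewrite mevalB rmorphXn /= mevalXU => /eqP.
  by rewrite subr_eq0 => /eqP.
have [F F0 hF] : exists2 F : 'I_n -> {poly K}, (forall i, F i != 0) &
    forall i v, zero_of J v -> (F i).[v i] = 0.
  have /choice[F hF] : forall i, exists F : {poly K}, F != 0 /\
      forall v, zero_of J v -> F.[v i] = 0.
    by move=> i; have [F F0 FJ] := equation i; exists F.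
  by exists F => i; have [] := hF i.
pose r i := sval (closed_field_poly_normal (F i)).
have hr i : F i = lead_coef (F i) *: \prod_(z <- r i) ('X - z%:P).
  exact: svalP (closed_field_poly_normal (F i)).
pose rts := flatten [seq r i | i : 'I_n].
exists [seq [ffun i => val (g i)] | g : {ffun 'I_n -> seq_sub rts}].
move=> v [[i vi] Iv].
have lv : l.@[v] != 0.
  apply: contraNneq vi => lv.
  have [N [a Ia]] : exists N, adjoin I l ('X_i ^+ N).
    by exists M; rewrite mpolyXn; apply: hM; rewrite mdegMn mdeg1 mul1n.
  have := Iv _ Ia; rewrite mevalB mevalM lv mulr0 subr0 rmorphXn /= mevalXU => /eqP.
  by rewrite expf_eq0 => /andP[].
exists (l.@[v])^-1; rewrite ?invr_eq0 //.
set w := fun i => (l.@[v])^-1 * v i.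
have Jw : zero_of J w.
  move=> p [a Ia]; have : (p - a * (l - 1)).@[w] = 0.
    rewrite [p - _](@pihomog_partitionE _ _ mdeg (msize (p - a * (l - 1)))) //.
    rewrite rmorph_sum big1 //= => k _.
    by rewrite (meval_homog _ _ (pihomogP _ _ _)) (Iv _ (hI k _ Ia)) mulr0.
  rewrite mevalB mevalM mevalB meval1 (meval_homog _ _ hl) expr1 mulVf //.
  by rewrite subrr mulr0 subr0.
have w_rts j : w j \in rts.
  apply/flattenP; exists (r j); first by apply: map_f; rewrite mem_enum.
  have := hF j w Jw; rewrite hr hornerZ => /eqP.
  rewrite mulf_eq0 lead_coef_eq0 (negPf (F0 j)) /= => /eqP root_j.
  by rewrite -root_prod_XsubC; apply/eqP.
apply/mapP; exists [ffun j => SeqSub (w_rts j)]; first by rewrite mem_enum.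
by apply/ffunP => j; rewrite !ffunE.
Qed.

End FinitePoints.

(** * Ideals generated by variables *)

Section VariableIdeals.
Variables (K : fieldType) (n : nat).
Local Notation P := {mpoly K[n]}.

Definition variable_ideal (s : seq 'I_n) : set P :=
  adjoin_seq [set 0]%classic [seq 'X_i | i <- s].

Lemma graded_zero_ideal : graded_ideal ([set 0]%classic : set P).
Proof.
split; last by move=> k p /= ->; rewrite pihomog0.
by split=> [//|p q /= -> ->|a p /= ->]; rewrite ?addr0 ?mulr0.
Qed.

Lemma variable_positive_form (s : seq 'I_n) x :
  x \in [seq 'X_i : P | i <- s] -> positive_form x.
Proof.
by case/mapP=> i _ ->; exists 1%N => //; rewrite dhomogX; apply/eqP; exact: mdeg1.
Qed.

Lemma graded_variable_ideal s : graded_ideal (variable_ideal s).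
Proof.
by apply: graded_adjoin_seq (@variable_positive_form s); exact: graded_zero_ideal.
Qed.

(** Modulo the variables in [s] a polynomial is what remains of it after these
    are set to zero, hence the quotient is a polynomial ring and a domain. *)
Lemma nonzerodivisor_variable s i :
  i \notin s -> nonzerodivisor_mod (variable_ideal s) 'X_i.
Proof.
move=> nis.
pose theta : {rmorphism P -> P} :=
  comp_mpoly [tuple if j \in s then 0 else 'X_j : P | j < n].
have thetaX j : theta 'X_j = if j \in s then 0 else 'X_j.
  by rewrite /= comp_mpolyXU -tnth_nth tnth_mktuple.
have idI := (graded_variable_ideal s).1.
have kerP p : variable_ideal s p <-> theta p = 0.
  split=> [|p0].
    apply: (@adjoin_seq_min _ _ _ [set q | theta q = 0]%classic) => /= [|q ->|x].
    - split=> [|p1 q /= p0 q0|a q /= q0]; rewrite /= ?rmorph0 //.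
        by rewrite rmorphD /= p0 q0 addr0.
      by rewrite rmorphM /= q0 mulr0.
    - exact: rmorph0.
    - by case/mapP=> j js ->; rewrite thetaX js.
  rewrite -[p]subr0 -p0; apply: substitution_congr => // [c|j].
    by rewrite /= comp_mpolyC.
  rewrite thetaX; case: ifP => [js|_]; last by rewrite subrr; exact: ideal0.
  by rewrite subr0; apply: mem_adjoin_seq; [exact: graded_zero_ideal.1 | exact: map_f].
move=> p /kerP; rewrite rmorphM thetaX (negPf nis) => /eqP.
rewrite mulf_eq0 => /orP[/eqP/(congr1 (mcoeff U_(i)))|/eqP/kerP //].
by rewrite mcoeffXU eqxx mcoeff0 => /eqP; rewrite oner_eq0.
Qed.

Lemma regular_variables s : uniq s -> regular [set 0]%classic [seq 'X_i : P | i <- s].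
Proof.
elim/last_ind: s => //= s i ih; rewrite rcons_uniq map_rcons => /andP[nis us].
by apply/regular_rcons; split; [exact: ih | exact: nonzerodivisor_variable].
Qed.

Lemma variable_ideal_socle s : (forall i, i \in s) ->
  socle_line (variable_ideal s) 0 1 /\ irrelevant_primary (variable_ideal s).
Proof.
move=> sT; have idI := (graded_variable_ideal s).1.
have Xs i : variable_ideal s 'X_i.
  by apply: mem_adjoin_seq; [exact: graded_zero_ideal.1 | exact/map_f/sT].
split; last by apply: primary_variables => // i; exists 1%N; exact: Xs.
split=> [||i|z _].
- exact: dhomog1.
- move=> I1; suff : (1 : P).@[fun _ => 0 : K] = 0.
    by rewrite meval1 => /eqP; rewrite oner_eq0.
  apply: (@adjoin_seq_min _ _ _ [set q | q.@[fun _ => 0] = 0]%classic _ _ _ _ _ I1) => /= [|q ->|x].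
  + split=> [|p1 q /= p0 q0|a q /= q0]; rewrite /= ?meval0 //.
      by rewrite mevalD p0 q0 addr0.
    by rewrite mevalM q0 mulr0.
  + exact: meval0.
  + by case/mapP=> j js ->; rewrite mevalXU.
- by rewrite mulr1.
- exists z.@[fun _ => 0]; rewrite alg_mpolyC.
  by apply: evaluation_congr => // i; rewrite mpolyC0 subr0.
Qed.

End VariableIdeals.

(** * Exchanging linear forms for forms of higher degree *)

Section Chain.
Variables (K : closedFieldType) (n : nat).
Hypothesis uncK : uncountable_field K.
Local Notation P := {mpoly K[n]}.
Local Notation ideal_of s := (adjoin_seq [set 0]%classic (s : seq P)).

Lemma graded_ideal_of (s : seq P) :
  (forall x, x \in s -> positive_form x) -> graded_ideal (ideal_of s).
Proof. by move=> hs; apply: graded_adjoin_seq hs; exact: graded_zero_ideal. Qed.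

Lemma adjoin_congr (I : set P) x y : is_ideal I -> I (x - y) -> adjoin I x = adjoin I y.
Proof.
move=> idI Ixy; apply/predeqP => p; split=> -[a Ia]; exists a.
  have -> : p - a * y = (p - a * x) + a * (x - y) by ring.
  by apply: idealD => //; exact: idealM.
have -> : p - a * x = (p - a * y) - a * (x - y) by ring.
by apply: idealB => //; exact: idealM.
Qed.

Lemma horner_comb_ideal (I : set P) t hs : is_ideal I ->
  adjoin_seq I hs (horner_comb t hs).
Proof.
elim: hs I => [|h hs ih] I idI /=; first exact: ideal0.
have idh := ideal_adjoin idI h; have idhs := ideal_adjoin_seq hs idh.
apply: idealD => //; first exact/sub_adjoin_seq/mem_adjoin.
by apply: idealZ => //; exact: ih.
Qed.

(** The combination is [h] plus a multiple of what [hs] generates. *)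
Lemma adjoin_seq_comb (I : set P) t h hs : is_ideal I ->
  adjoin_seq I (horner_comb t (h :: hs) :: hs) = adjoin_seq I (h :: hs).
Proof.
move=> idI; rewrite /= !adjoin_seq_adjoin.
apply: adjoin_congr; first exact: ideal_adjoin_seq.
rewrite addrC addKr; apply: idealZ; first exact: ideal_adjoin_seq.
exact: horner_comb_ideal.
Qed.

Definition all_homog e (s : seq P) : Prop := forall x, x \in s -> x \is e.-homog.

Definition common_zeros (s : seq P) v : Prop := forall x, x \in s -> x.@[v] = 0.

Definition gorenstein_seq (s : seq P) d : Prop :=
  [/\ regular [set 0]%classic s, irrelevant_primary (ideal_of s)
    & exists w, socle_line (ideal_of s) d w].

(** Moving [x] to the end of the regular sequence makes it a nonzerodivisor
    modulo all the others, and then [y] can take its place. The result is stated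
    with [y] at the end, where the next exchange expects it. *)
Lemma gorenstein_exchange e d x y s : 
  (0 < e)%N -> (forall z, z \in s -> positive_form z) ->
  x \is 1.-homog -> y \is e.-homog ->
  irrelevant_primary (ideal_of (y :: s)) ->
  gorenstein_seq (x :: s) d -> gorenstein_seq (rcons s y) (d + e.-1).
Proof.
move=> e0 hs hx hy pry [rx _ [w sw]].
have grs := graded_ideal_of hs.
have px : positive_form x by exists 1%N.
have [rs nx] : regular [set 0]%classic s /\ nonzerodivisor_mod (ideal_of s) x.
  apply/regular_rcons/regular_rot => //; first exact: graded_zero_ideal.
  by move=> z; rewrite inE => /predU1P[->|/hs].
rewrite /= adjoin_seq_adjoin in pry; rewrite /= adjoin_seq_adjoin in sw.
have ny := nonzerodivisor_exchange grs px pry nx.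
split; rewrite ?adjoin_seq_rcons //; first by apply/regular_rcons.
have le1 : (1 <= d + e)%N by rewrite addn_gt0 e0 orbT.
have [w' sw'] := socle_exchange grs (ltn0Sn 0) e0 le1 hx hy nx ny sw.
by exists w'; move: sw'; rewrite -addnBA // subn1.
Qed.

(** As long as a linear form [L] of [Ls] remains, the ideal of the other members of
    the sequence has finitely many projective zeros. The form [l] and all of [gs]
    vanish at them, so [hs] does not, and a generic combination of [hs] can be
    exchanged for [L]. It also replaces the first element of [hs], which keeps
    the ideal of [gs ++ hs] unchanged. *)
Lemma exchange_chain e d l Ls gs hs : (0 < e)%N ->
  l \is 1.-homog -> all_homog 1 Ls -> all_homog e gs -> all_homog e hs ->
  size hs = (size Ls).+1 ->
  (forall v, common_zeros (l :: gs ++ hs) v -> ~ nonzero_point v) ->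
  gorenstein_seq (Ls ++ l :: gs) d ->
  exists gs' g, [/\ all_homog e gs', g \is e.-homog,
    gorenstein_seq (l :: gs') (d + size Ls * e.-1)
    & ideal_of (gs ++ hs) = ideal_of (rcons gs' g)].
Proof.
move=> e0 hl; elim: Ls d gs hs => [|L Ls ih] d gs [|h hs] //= hLs hgs hhs [szhs] noz gor.
  case: hs {noz} hhs szhs => // hh _; exists gs, h; split=> //.
  - by apply: hh; rewrite mem_head.
  - by rewrite mul0n addn0.
  - by rewrite cats1.
have hL : L \is 1.-homog by apply: hLs; rewrite mem_head.
pose s := Ls ++ l :: gs; pose I := ideal_of s.
have ps x : x \in s -> positive_form x.
  rewrite mem_cat inE => /or3P[xLs|/eqP->|xgs]; [exists 1%N | exists 1%N | exists e] => //.
    by apply: hLs; rewrite inE xLs orbT.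
  exact: hgs.
have grI : graded_ideal I := graded_ideal_of ps.
have finZ : finitely_many_lines (fun v => nonzero_point v /\ zero_of I v).
  apply: finite_zeros hL _ => //.
  by have [_ + _] := gor; rewrite /= adjoin_seq_adjoin.
have [t ht] : exists t, forall v, nonzero_point v /\ zero_of I v ->
    (horner_comb t (h :: hs)).@[v] != 0.
  apply: generic_combination finZ hhs _ => v [v0 Iv].
  apply: contrapT => hv; apply: (noz v) => // x.
  have idI := graded_zero_ideal K n.
  rewrite inE mem_cat => /or3P[/eqP->|xgs|xhs].
  - by apply: Iv; apply: mem_adjoin_seq idI.1 _; rewrite mem_cat mem_head orbT.
  - by apply: Iv; apply: mem_adjoin_seq idI.1 _; rewrite mem_cat inE xgs !orbT.
  - by apply/eqP; apply: contraT => xv; case: hv; exists x.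
pose g := horner_comb t (h :: hs).
have hg : g \is e.-homog by exact: horner_comb_homog.
have prg : irrelevant_primary (ideal_of (g :: s)).
  rewrite /= adjoin_seq_adjoin; apply: projective_nullstellensatz => //.
    exact: graded_adjoin hg.
  move=> v hv i; apply/eqP; apply: contraT => vi.
  have /ht/negP[] : nonzero_point v /\ zero_of I v.
    by split; [exists i | move=> p Ip; apply/hv/sub_adjoin].
  by apply/eqP/hv/mem_adjoin; exact: grI.1.
have gor' := gorenstein_exchange e0 ps hL hg prg gor.
rewrite rcons_cat rcons_cons -/s in gor'.
have [|||||gs' [g' [hgs' hg' gorf eqJ]]] := ih _ (rcons gs g) hs _ _ _ _ _ gor'.
- by move=> x xLs; apply: hLs; rewrite inE xLs orbT.
- by move=> x; rewrite mem_rcons inE => /predU1P[->|/hgs].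
- by move=> x xhs; apply: hhs; rewrite inE xhs orbT.
- by [].
- move=> v hv; apply: noz => x; rewrite inE mem_cat inE => /or4P[xl|xgs|/eqP->|xhs].
  + by apply: hv; rewrite inE xl.
  + by apply: hv; rewrite inE mem_cat mem_rcons inE xgs !orbT.
  + have gv : g.@[v] = 0 by apply: hv; rewrite inE mem_cat mem_rcons mem_head orbT.
    move: gv; rewrite meval_horner_comb /= horner_cons.
    rewrite [Poly _](_ : _ = 0) ?horner0 ?mul0r ?add0r //.
    apply/polyP => j; rewrite coef_Poly coef0.
    have [ltj|lej] := ltnP j (size hs); last by rewrite nth_default ?size_map.
    rewrite (nth_map 0) //; apply: hv.
    by rewrite inE mem_cat mem_nth ?orbT.
  + by apply: hv; rewrite inE mem_cat xhs !orbT.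
exists gs', g'; split=> //.
  by rewrite mulSn addnA.
rewrite -eqJ cat_rcons /adjoin_seq !foldl_cat -!/(adjoin_seq _ _).
rewrite adjoin_seq_comb //; apply: ideal_adjoin_seq; exact: (graded_zero_ideal K n).1.
Qed.

End Chain.

(** * Functionals dual to the socle *)

Section DegreeRow.
Variables (K : fieldType) (n d : nat).
Local Notation P := {mpoly K[n]}.

(** Coordinates of the component of degree [d]. *)
Definition degree_row (p : P) : 'rV[K]_#|{: 'X_{1..n < d.+1}}| :=
  \row_j (pihomog mdeg d p)@_(enum_val j : 'X_{1..n < d.+1}).

Lemma degree_row_is_linear : linear degree_row.
Proof. by move=> c p q; apply/rowP => j; rewrite !mxE linearP mcoeffD mcoeffZ. Qed.

HB.instance Definition _ :=
  GRing.isLinear.Build K P 'rV[K]_#|{: 'X_{1..n < d.+1}}| _ degree_row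
    degree_row_is_linear.

Lemma degree_row_inj p q :
  degree_row p = degree_row q -> pihomog mdeg d p = pihomog mdeg d q.
Proof.
move=> /rowP h; apply/mpolyP => m.
have [md|md] := eqVneq (mdeg m) d.
  have ltm : (mdeg m < d.+1)%N by rewrite md.
  by have := h (enum_rank (BMultinom ltm)); rewrite !mxE enum_rankK.
by rewrite !(dhomog_nemf_coeff (pihomogP _ _ _) md).
Qed.

Lemma homog_span p : p \is d.-homog -> exists c : 'I_#|{: 'X_{1..n < d.+1}}| -> K,
  p = \sum_j c j *: pihomog mdeg d 'X_[(enum_val j : 'X_{1..n < d.+1})].
Proof.
move=> hp; exists (fun j => p@_(enum_val j : 'X_{1..n < d.+1})).
rewrite -{1}(pihomog_dE hp) {1}[p](mpolywE (msize_homog hp)) linear_sum /=.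
rewrite (reindex (@enum_val _ {: 'X_{1..n < d.+1}})) /=.
  by apply: eq_bigr => j _; rewrite linearZ.
by apply: onW_bij; exact: enum_val_bij.
Qed.

End DegreeRow.

Section SocleFunctional.
Variables (K : fieldType) (n : nat).
Local Notation P := {mpoly K[n]}.
Implicit Types (I : set P).

(** The last clause says that [(p, q) |-> phi (p * q)] is a perfect pairing on the
    quotient by [I]. *)
Definition dualizing_functional I d (phi : {scalar P}) : Prop :=
  [/\ forall p, I p -> phi p = 0,
      forall p, phi (pihomog mdeg d p) = phi p
    & forall p, (forall q, phi (q * p) = 0) -> I p].

(** Any linear form that is nonzero on the socle will do: a polynomial outside [I]
    has a multiple by a monomial of maximal degree that is still outside [I], and
    this multiple is in the socle. *)
Lemma socle_functional I d w : graded_ideal I -> irrelevant_primary I ->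
  socle_line I d w -> exists phi, dualizing_functional I d phi.
Proof.
move=> [idI grI] [N hN] [hw nw mw sw].
have [c [cI cw]] : exists c : 'cV[K]__, (forall p, I p -> degree_row d p *m c = 0) /\
    degree_row d w *m c != 0.
  apply: contrapT => hc; apply: nw.
  have [||p Ip] := @row_separation _ _ _ (degree_row d) I w.
  - split=> [|a p q Ip Iq]; first exact: ideal0.
    by apply: idealD => //; exact: idealZ.
  - move=> c cI; apply/eqP; apply: contraT => cw; case: hc; by exists c.
  - by move/degree_row_inj; rewrite (pihomog_dE hw) => <-; exact: grI.
pose f p := (degree_row d p *m c) 0 0.
have fP : linear_for *%R f by move=> a p q; rewrite /f linearP mulmxDl -scalemxAl !mxE.
have [phi [phiI phid phiw]] : exists phi : {scalar P}, [/\ forall p, I p -> phi p = 0,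
    forall p, phi (pihomog mdeg d p) = phi p & phi w != 0].
  pose phi : {scalar P} := HB.pack f (GRing.isLinear.Build K P K *%R f fP).
  exists phi; split=> [p Ip|p|] /=.
  - by rewrite /f cI // mxE.
  - by rewrite /f /degree_row pihomog_id.
  - apply: contraNneq cw => fw0; apply/eqP/matrixP => i j.
    by rewrite !ord1 [X in _ = X]mxE.
exists phi; split=> // p hp.
apply: contrapT => nIp.
(* [k] is the maximal degree of a monomial that keeps [p] outside [I]. *)
pose Q k := `[< exists2 m : 'X_{1..n}, mdeg m = k & ~ I ('X_[m] * p) >].
have exQ : exists k, Q k.
  by exists 0%N; apply/asboolP; exists 0%MM; rewrite ?mdeg0 // mpolyX0 mul1r.
have ubQ k : Q k -> (k <= N)%N.
  move=> /asboolP[m <- nIm]; rewrite leqNgt; apply: contra_notN nIm => /ltnW/hN Im.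
  exact: idealMr.
case: (ex_maxnP exQ ubQ) => k /asboolP[m mk nIm] maxk.
have [i|a Ia] := sw ('X_[m] * p).
  apply: contrapT => nIi; have /maxk : Q k.+1.
    apply/asboolP; exists (U_(i) + m)%MM; first by rewrite mdegD mdeg1 mk.
    by rewrite mpolyXD -mulrA.
  by rewrite ltnn.
have a0 : a != 0.
  by apply: contra_notN nIm => /eqP a0; move: Ia; rewrite a0 scale0r subr0.
have := phiI _ Ia; rewrite linearB /= hp sub0r linearZ /= => /eqP.
by rewrite oppr_eq0 mulf_eq0 (negPf a0) (negPf phiw).
Qed.

End SocleFunctional.

(** * The pairing defined by linkage *)

Section Linkage.
Variables (K : fieldType) (n : nat).
Local Notation P := {mpoly K[n]}.
Variables (I : set P) (u g : P) (N e d : nat) (phi : {scalar P}).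
Hypotheses (grI : graded_ideal I) (hu : u \is N.-homog) (hg : g \is e.-homog).
Hypothesis nzu : nonzerodivisor_mod I u.
Hypothesis dual_phi : dualizing_functional (adjoin I u) d phi.

(** The equation [u * p = g * p'] modulo [I]. With [u] a high power of a
    parameter modulo [I + (g)], it is solvable for [p'] if and only if [p] lies in
    the saturation of that ideal. *)
Definition linked p p' : Prop := I (u * p - g * p').

Let idI : is_ideal I := grI.1.

(** Multiplying [p' * q] and [p * q'] by [u] gives twice [g * p' * q']. *)
Lemma linked_sym p p' q q' :
  linked p p' -> linked q q' -> phi (p' * q) = phi (p * q').
Proof.
move=> lp lq; have [phiI _ _] := dual_phi.
apply/eqP; rewrite -subr_eq0 -linearB; apply/eqP/phiI/sub_adjoin/nzu.
have -> : u * (p' * q - p * q') = p' * (u * q - g * q') - q' * (u * p - g * p') by ring.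
by apply: idealB => //; exact: idealM.
Qed.

Lemma linked_gen_r p p' q : linked p p' -> adjoin I g q -> phi (p' * q) = 0.
Proof.
move=> lp [a Ia]; have [phiI _ _] := dual_phi; apply: phiI; exists (a * p).
have -> : p' * q - a * p * u = p' * (q - a * g) - a * (u * p - g * p') by ring.
by apply: idealB => //; exact: idealM.
Qed.

Lemma linked_gen_l p p' q q' :
  linked p p' -> linked q q' -> adjoin I g p -> phi (p' * q) = 0.
Proof.
by move=> lp lq Jp; rewrite (linked_sym lp lq) mulrC; exact: linked_gen_r lq Jp.
Qed.

Lemma phi_homogM t k x y : x \is t.-homog -> (t + k = d)%N ->
  phi (pihomog mdeg k y * x) = phi (y * x).
Proof.
move=> hx tk; have [_ phid _] := dual_phi.
by rewrite -[X in _ = X]phid (pihomogMhomog _ _ hx) -tk leq_addr addKn.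
Qed.

(** The polynomials [p'] of degree [t] that are linked to some [p] are those that
    annihilate [g] modulo [I + (u)], hence the orthogonal of the ideal of [g] for
    [phi]. The hypothesis puts [q] in the double orthogonal, which is that ideal
    again modulo [I + (u)]; the bound on the degree of [q] removes [u]. *)
Lemma linked_nondegenerate k t k' q : (t + k' = d)%N -> (t + e = k + N)%N ->
  (k' < N)%N -> q \is k'.-homog ->
  (forall p p', p \is k.-homog -> p' \is t.-homog -> linked p p' -> phi (p' * q) = 0) ->
  adjoin I g q.
Proof.
move=> td te ltN hq hperp; have [phiI _ phin] := dual_phi.
have grJ := graded_adjoin grI hg; have idJ := grJ.1.
have idJu := ideal_adjoin idJ u.
pose mon (j : 'I_#|{: 'X_{1..n < t.+1}}|) : P :=
  pihomog mdeg t 'X_[(enum_val j : 'X_{1..n < t.+1})].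
pose f x := \row_j phi (mon j * x).
have fP : linear f.
  by move=> a x y; apply/rowP => j; rewrite !mxE mulrDr -scalerAr linearP.
pose ev : {linear P -> 'rV[K]_#|{: 'X_{1..n < t.+1}}|} := HB.pack f (GRing.isLinear.Build K P _ _ f fP).
have evc x (c : 'cV_#|{: 'X_{1..n < t.+1}}|) :
    ev x *m c = (phi ((\sum_j c j 0 *: mon j) * x))%:M.
  apply/matrixP => i j; rewrite !ord1 !mxE mulr1n mulr_suml linear_sum /=.
  by apply: eq_bigr => l _; rewrite mxE -scalerAl linearZ /= mulrC.
have [||s [hs Ss] evs] := @row_separation _ _ _ ev
    [set x | x \is k'.-homog /\ adjoin (adjoin I g) u x]%classic q.
- split=> [|a x y [hx Sx] [hy Sy]]; split; rewrite ?rpred0 //; first exact: ideal0.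
    by rewrite rpredD ?rpredZ.
  by apply: idealD => //; exact: idealZ.
- move=> c cS; rewrite evc; set a := \sum_j _.
  have ha : a \is t.-homog by apply: rpred_sum => j _; apply/rpredZ/pihomogP.
  have aS x : adjoin I g x -> phi (a * x) = 0.
    move=> Jx; rewrite mulrC -(phi_homogM x ha td).
    have /matrixP/(_ 0 0) := cS (pihomog mdeg k' x) (conj (pihomogP _ _ _) (sub_adjoin _ (grJ.2 _ _ Jx))).
    by rewrite evc !mxE mulr1n mulrC.
  have [||p hp Ip] := graded_adjoin_homog (k := k) grI hu (p := g * a).
  + by rewrite -te addnC; apply: dhomogM.
  + apply: phin => r; have -> : r * (g * a) = a * (r * g) by ring.
    by apply: aS; exists r; rewrite subrr; exact: ideal0.
  + rewrite (hperp p a) ?mulr0 ?raddf0 // /linked.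
    by rewrite mulrC -opprB; exact: idealN.
have [c Jqc] : adjoin (adjoin I g) u q.
  have -> : q = s + (q - s) by rewrite addrC subrK.
  apply: idealD => //; suff [b Ib] : adjoin I u (q - s).
    by exists b; exact: sub_adjoin.
  apply: phin => r; rewrite -(phi_homogM (t := k') (k := t)) ?rpredB ?(addnC k') //.
  have [c ->] := homog_span (pihomogP mdeg t r).
  pose c' : 'cV[K]_#|{: 'X_{1..n < t.+1}}| := \col_j c j.
  have := evc (q - s) c'; rewrite linearB evs subrr mul0mx => /matrixP/(_ 0 0).
  rewrite !mxE mulr1n => /esym; apply: etrans; congr (phi (_ * _)).
  by apply: eq_bigr => j _; rewrite mxE.
exact: (graded_low_degree grJ hu Jqc (leq_trans (msize_homog hq) ltN)).
Qed.

End Linkage.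

(** * The gradient ideal and the singular points *)

Section GeneratedIdeals.
Variables (K : fieldType) (n : nat).
Local Notation P := {mpoly K[n]}.
Implicit Types (S : set P) (f : P).

Lemma is_ideal_gen S : is_ideal (ideal_gen S).
Proof. by split; [exact: ideal_gen0 | exact: ideal_genD | exact: ideal_genM]. Qed.

Lemma mem_ideal_gen S x : S x -> ideal_gen S x.
Proof.
move=> Sx; exists [:: (1, x)]; last by rewrite big_seq1 mul1r.
by move=> y; rewrite inE => /eqP->.
Qed.

Lemma ideal_gen_min S (J : set P) p : is_ideal J -> (forall x, S x -> J x) ->
  ideal_gen S p -> J p.
Proof.
move=> idJ SJ [s hs ->]; apply: ideal_sum => // x xs _.
by apply: idealM => //; apply/SJ/hs.
Qed.

Lemma graded_ideal_gen S : (forall x, S x -> exists e, x \is e.-homog) ->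
  graded_ideal (ideal_gen S).
Proof.
move=> hS; have idS := is_ideal_gen S; split=> // k p [s hs ->].
rewrite linear_sum; apply: ideal_sum => // x xs _ /=.
have [e hx] := hS _ (hs x xs); rewrite (pihomogMhomog _ _ hx).
case: ifP => _; last exact: ideal0.
by apply: idealM => //; apply/mem_ideal_gen/hs.
Qed.

Definition partials f : seq P := [seq f^`M(i) | i : 'I_n].

Lemma gradient_ideal_partials f :
  gradient_ideal f = adjoin_seq [set 0]%classic (partials f).
Proof.
have id0 := (graded_zero_ideal K n).1.
apply/predeqP => p; split.
  apply: ideal_gen_min; first exact: ideal_adjoin_seq.
  by move=> _ [i _ <-]; apply: mem_adjoin_seq => //; apply: map_f; rewrite mem_enum.
apply: adjoin_seq_min; first exact: is_ideal_gen.
  by move=> _ ->; exact: ideal_gen0.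
by move=> _ /mapP[i _ ->]; apply: mem_ideal_gen; exists i.
Qed.

Lemma mderiv_homog d f i : f \is d.-homog -> f^`M(i) \is d.-1.-homog.
Proof.
move=> hf; apply/dhomogP => m; rewrite mcoeff_msupp mcoeff_deriv => fm.
have : (m + U_(i))%MM \in msupp f.
  by rewrite mcoeff_msupp; apply: contraNneq fm => ->; rewrite mul0rn.
by move/(dhomog_mf hf) => /= <-; rewrite mdegD mdeg1 addn1.
Qed.

Lemma euler_identity d f : f \is d.-homog -> \sum_i 'X_i * f^`M(i) = d%:R *: f.
Proof.
move=> hf; rewrite {2}[f]mpolyE scaler_sumr.
have derE i : f^`M(i) = \sum_(m <- msupp f) f@_m *: ('X_[m])^`M(i).
  by rewrite {1}[f]mpolyE linear_sum; apply: eq_bigr => m _; rewrite linearZ.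
under eq_bigr do rewrite derE mulr_sumr.
rewrite exchange_big; apply: eq_big_seq => m mf /=.
have termE i : 'X_i * (f@_m *: ('X_[m])^`M(i)) = (m i)%:R *: (f@_m *: 'X_[m]).
  rewrite mderivX -!scalerAr -mpolyXD scalerA mulrC -scalerA.
  have [->|mi] := eqVneq (m i) 0%N; first by rewrite !scale0r.
  by rewrite addmC submK // lep1mP.
under eq_bigr do rewrite termE.
rewrite -scaler_suml -natr_sum -mdegE.
by have /= -> := dhomog_mf hf mf.
Qed.

End GeneratedIdeals.

Section SingularPoints.
Variables (K : closedFieldType) (n : nat).
Hypothesis uncK : uncountable_field K.
Local Notation P := {mpoly K[n]}.

(** The partials, together with a form that isolates each singular point, have no
    projective zero in common. By the Nullstellensatz powers of the variables are
    combinations of finitely many of these forms, and every singular point is the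
    one isolated by a form among these finitely many. *)
Lemma isolated_finitely_many_lines e (f : P) :
  (forall i, f^`M(i) \is e.-homog) ->
  (forall v : 'I_n -> K, (forall i, (f^`M(i)).@[v] = 0) -> f.@[v] = 0) ->
  isolated_singularities f -> finitely_many_lines (singular_point f).
Proof.
move=> hf euler isol.
pose isolating v g := g.@[v] != 0 /\ forall w, singular_point f w ->
  g.@[w] != 0 -> exists c : K, forall i, w i = c * v i.
pose S : set P := [set g | (exists i, g = f^`M(i)) \/
  (exists e, g \is e.-homog) /\ exists v, isolating v g]%classic.
have grS : graded_ideal (ideal_gen S).
  by apply: graded_ideal_gen => x [[i ->]|[]//]; exists e.
have [v hv|N hN] := projective_nullstellensatz uncK grS.
  move=> i; apply/eqP; apply: contraT => vi.
  have grad0 j : (f^`M(j)).@[v] = 0 by apply/hv/mem_ideal_gen; left; exists j.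
  have singv : singular_point f v by split; [exists i | exact: euler |].
  have [e' [g [hg gv0 hw]]] := isol v singv.
  have := gv0; rewrite hv ?eqxx //; apply: mem_ideal_gen; right.
  by split; [exists e' | exists v].
have /choice[s hs] : forall i : 'I_n, exists s : seq (P * P),
    (forall x, x \in s -> S x.2) /\ 'X_i ^+ N = \sum_(x <- s) x.1 * x.2.
  move=> i; have [|s] := hN (U_(i) *+ N)%MM; first by rewrite mdegMn mdeg1 mul1n.
  by exists s; rewrite mpolyXn.
have /choice[cen hcen] : forall g : P, exists c : {ffun 'I_n -> K},
    (exists v, isolating v g) -> isolating c g.
  move=> g; have [[v [gv hv]]|no] := pselect (exists v, isolating v g); last by exists 0.
  exists [ffun i => v i] => _; split.
    by rewrite (meval_eq (v2 := v)) // => i; rewrite ffunE.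
  by move=> w sw gw; have [c wc] := hv w sw gw; exists c => i; rewrite ffunE.
exists [seq cen x.2 | x <- flatten [seq s i | i : 'I_n]] => w sw.
have [[i wi] _ grad0] := sw; have [hsi XiE] := hs i.
have [x xs x2] : exists2 x, x \in s i & x.2.@[w] != 0.
  apply: contrapT => no; have := congr1 (meval w) XiE.
  rewrite rmorphXn /= mevalXU rmorph_sum big_seq big1 /= => [/eqP|x xs].
    by rewrite expf_eq0 (negPf wi) andbF.
  rewrite mevalM; have [->|x2] := eqVneq (x.2).@[w] 0; first by rewrite mulr0.
  by case: no; exists x.
have [[j Ex]|[_ /hcen[_ hx]]] := hsi x xs; first by move: x2; rewrite Ex grad0 eqxx.
have [c wc] := hx w sw x2.
have c0 : c != 0 by apply: contraNneq wi => c0; rewrite wc c0 mul0r.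
exists c^-1; first by rewrite invr_eq0.
apply/mapP; exists x; first by apply/flattenP; exists (s i) => //; apply: map_f; rewrite mem_enum.
by apply/ffunP => k; rewrite ffunE wc mulKf.
Qed.

End SingularPoints.

(** Countable sets of reals have measure zero, and the unit interval has measure
    one. *)
Lemma complex_uncountable (R : realType) : uncountable_field R[i].
Proof.
move=> h; apply: contrapT => /forallNP fin.
have cR : countable [set: R].
  rewrite (_ : [set: R] = \bigcup_(M in [set: nat]) [set x | (h x%:C%C <= M)%N])%classic.
    apply: bigcup_countable => // M _; apply: finite_set_countable.
    have /contrapT finM := fin M.
    apply: (sub_finite_set _ (finite_image (@complex.Re R) finM)) => x /= hx.
    by exists x%:C%C.
  by apply/predeqP => x; split=> // _; exists (h x%:C%C) => //=.
have := lebesgue_measure.lebesgue_measure_itv (`[0%R, 1%R] : interval R).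
rewrite lebesgue_measure.countable_lebesgue_measure0; last first.
  exact: sub_countable (subset_card_le (@subsetT _ _)) cR.
rewrite /= constructive_ereal.lte_fin ltr01.
move=> /(congr1 constructive_ereal.fine); rewrite /= subr0 => /eqP.
by rewrite eq_sym oner_eq0.
Qed.

(** * Perfect pairings of vector spaces *)

Section PerfectPairing.
Variables (K : fieldType) (U V : lmodType K) (beta : U -> V -> K).
Hypothesis beta_linear_l : forall y, linear_for *%R (beta^~ y).
Hypothesis beta_linear_r : forall x, linear_for *%R (beta x).

(** Finite dimension of [V] is enough: a linear form on [V] outside the image of [U]
    would be separated from it by a vector of [V] orthogonal to all of [U]. *)
Lemma perfect_pairing_isomorphic m (a : 'I_m -> V) :
  (forall v, exists c : 'I_m -> K, v = \sum_i c i *: a i) ->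
  (forall x, (forall y, beta x y = 0) -> x = 0) ->
  (forall y, (forall x, beta x y = 0) -> y = 0) ->
  lmod_isomorphic U (dual V).
Proof.
move=> aV nondegl nondegr.
have form x : linear_form_pred (beta x : V -> K^o) by apply/asboolP; exact: beta_linear_r.
pose b x : dual V := exist _ (beta x : V -> K^o) (form x).
have bP : linear b.
  move=> c x y; apply: val_inj; apply/funext => v; exact: beta_linear_l.
pose phi : {linear U -> dual V} := HB.pack b (GRing.isLinear.Build K U (dual V) _ b bP).
have dual_sum (l : dual V) (c : 'I_m -> K) (w : 'I_m -> V) :
    val l (\sum_i c i *: w i) = \sum_i c i * val l (w i).
  have /asboolP ll := valP l.
  pose g : {linear V -> K^o} := HB.pack (val l) (GRing.isLinear.Build K V K^o _ (val l) ll).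
  by rewrite -[val l]/(g : V -> K^o) linear_sum; apply: eq_bigr => i _; rewrite linearZ.
have surj (l : dual V) : exists x, phi x = l.
  pose e (l : dual V) := \row_i (val l (a i) : K).
  have eP : linear e by move=> c l1 l2; apply/rowP => i; rewrite !mxE.
  pose ev : {linear dual V -> 'rV[K]_m} := HB.pack e (GRing.isLinear.Build K (dual V) _ _ e eP).
  have [|c hc|_ [x _ <-] evx] := @row_separation _ _ _ ev (range phi) l.
  - split=> [|c _ _ [x _ <-] [y _ <-]]; first by exists 0; rewrite ?linear0.
    by exists (c *: x + y); rewrite ?linearP.
  - pose v := \sum_i c i 0 *: a i.
    have evc l' : ev l' *m c = (val l' v)%:M.
      apply/matrixP => i j; rewrite !ord1 !mxE mulr1n dual_sum.
      by apply: eq_bigr => k _; rewrite mxE mulrC.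
    have v0 : v = 0.
      apply: nondegr => x; have /matrixP/(_ 0 0) := hc (phi x) (imageT _ _).
      by rewrite evc !mxE mulr1n.
    rewrite evc v0 [val l 0](_ : _ = 0) ?raddf0 //.
    have := dual_sum l (fun _ => 0) a.
    rewrite !big1 // => i _; [by rewrite mul0r | by rewrite scale0r].
  - exists x; apply: val_inj; apply/funext => v; have [c ->] := aV v.
    rewrite !dual_sum; apply: eq_bigr => i _; congr (_ * _).
    by have /rowP/(_ i) := evx; rewrite !mxE.
have [psi psiK] := choice surj.
exists phi; exists psi => // x; apply/eqP; rewrite -subr_eq0; apply/eqP/nondegl => y.
have /(congr1 (fun l : dual V => val l y)) : phi (psi (phi x) - x) = 0.
  by rewrite linearB psiK subrr.
by [].
Qed.

End PerfectPairing.

(** * Saturation by powers of a parameter *)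

Section Saturation.
Variables (K : fieldType) (n : nat).
Local Notation P := {mpoly K[n]}.
Implicit Types (I J : set P) (p q l x : P).

Lemma adjoin_pow I l x N : is_ideal I -> adjoin I l x -> adjoin I (l ^+ N) (x ^+ N).
Proof.
move=> idI [c Ic]; exists (c ^+ N); rewrite -exprMn subrXX.
exact: idealMr.
Qed.

Lemma primary_adjoin_pow I l N : is_ideal I -> irrelevant_primary (adjoin I l) ->
  irrelevant_primary (adjoin I (l ^+ N)).
Proof.
move=> idI [M hM]; apply: primary_variables => [|i]; first exact: ideal_adjoin.
exists (M * N)%N; rewrite exprM; apply: adjoin_pow => //.
by rewrite mpolyXn; apply: hM; rewrite mdegMn mdeg1 mul1n.
Qed.

Definition degree_ge k : set P := [set p | forall m, m \in msupp p -> (k <= mdeg m)%N].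

Lemma degree_geM k k' p q :
  degree_ge k p -> degree_ge k' q -> degree_ge (k + k') (p * q).
Proof.
move=> hp hq m /msuppM_le/allpairsP[[m1 m2] /= [m1p m2q ->]].
by rewrite mdegD leq_add ?hp ?hq.
Qed.

Lemma ideal_degree_ge k : is_ideal (degree_ge k).
Proof.
split=> [m|p q hp hq m /msuppD_le|a p hp]; first by rewrite msupp0.
  by rewrite mem_cat => /orP[/hp|/hq].
by rewrite -[k]add0n; apply: degree_geM.
Qed.

Lemma ideal_exp_degree_ge k p : ideal_exp (@irrelevant_ideal K n) k p -> degree_ge k p.
Proof.
elim: k p => [//|k ih] p; apply: ideal_gen_min; first exact: ideal_degree_ge.
move=> _ [a [b [ha /ih hb ->]]]; rewrite -add1n; apply: degree_geM => //.
apply: ideal_gen_min ha; first exact: ideal_degree_ge.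
by move=> _ [i _ <-] m /mem_msuppXP<-; rewrite mdeg1.
Qed.

Lemma irrelevant_ideal_form l : l \is 1.-homog -> irrelevant_ideal l.
Proof.
move=> hl; rewrite -[l]mulr1; apply: ideal_positive_form; first exact: is_ideal_gen.
  by exists 1%N.
by move=> i; rewrite mulr1; apply: mem_ideal_gen; exists i.
Qed.

Lemma saturation_pow J l p : l \is 1.-homog ->
  ideal_saturation (@irrelevant_ideal K n) J p -> exists N, J (l ^+ N * p).
Proof.
move=> hl [N hN]; exists N; apply: hN; elim: N => [//|N ih].
by apply: mem_ideal_gen; exists l, (l ^+ N); rewrite exprS; split=> //; exact: irrelevant_ideal_form.
Qed.

(** If [l] is a parameter modulo [J], a power of the irrelevant ideal lies in
    [J + (l ^ N)], and this ideal multiplies [p] into [J]. *)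
Lemma pow_saturation J l p N : is_ideal J -> irrelevant_primary (adjoin J l) ->
  J (l ^+ N * p) -> ideal_saturation (@irrelevant_ideal K n) J p.
Proof.
move=> idJ prJ Jp; have [M hM] := primary_adjoin_pow N idJ prJ.
exists M => q /ideal_exp_degree_ge hq; rewrite [q]mpolyE mulr_suml.
apply: ideal_sum => // m mq _; rewrite -scalerAl; apply: idealZ => //.
have [c Jc] := hM m (hq m mq).
have -> : 'X_[m] * p = p * ('X_[m] - c * l ^+ N) + c * (l ^+ N * p) by ring.
by apply: idealD => //; exact: idealM.
Qed.

(** The polynomials in question form a subspace of a finite-dimensional space, so
    the exponents for a finite spanning family suffice. *)
Lemma uniform_exponent J l k : is_ideal J -> exists N, forall p, p \is k.-homog ->
  (exists M, J (l ^+ M * p)) -> J (l ^+ N * p).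
Proof.
move=> idJ.
have mono M N p : (M <= N)%N -> J (l ^+ M * p) -> J (l ^+ N * p).
  by move=> leMN Jp; rewrite -(subnK leMN) exprD -mulrA; exact: idealM.
pose S : set P := [set p | p \is k.-homog /\ exists M, J (l ^+ M * p)]%classic.
pose mon (j : 'I_#|{: 'X_{1..n < k.+1}}|) : P :=
  pihomog mdeg k 'X_[(enum_val j : 'X_{1..n < k.+1})].
have subS : subspace S.
  split; first by split; [exact: rpred0 | exists 0%N; rewrite mulr0; exact: ideal0].
  move=> c p q [hp [M Jp]] [hq [M' Jq]]; split; first by rewrite rpredD ?rpredZ.
  exists (M + M')%N; rewrite mulrDr -scalerAr; apply: idealD => //.
    by apply: idealZ => //; apply: mono Jp; exact: leq_addr.
  by apply: mono Jq; exact: leq_addl.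
have [|b [bS spanb]] := @subspace_span _ _ _ mon S subS.
  by move=> p [/homog_span].
have /choice[M hM] : forall j, exists M, J (l ^+ M * b j) by move=> j; case: (bS j).
exists (\sum_j M j)%N => p hp Jp; have [c ->] := spanb p (conj hp Jp).
rewrite mulr_sumr; apply: ideal_sum => // j _ _; rewrite -scalerAr.
apply: idealZ => //; apply: mono (hM j); by rewrite (bigD1 j) //= leq_addr.
Qed.

End Saturation.

(** * Duality of the local cohomology *)

Section LinkagePairing.
Variables (K : fieldType) (n : nat) (f : {mpoly K[n]}).
Local Notation P := {mpoly K[n]}.
Variables (I : set P) (l g : P) (N e d k k' t t' : nat) (phi : {scalar P}).
Local Notation J := (gradient_ideal f).
Hypotheses (grI : graded_ideal I) (hl : l \is 1.-homog) (hg : g \is e.-homog).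
Hypothesis nzl : nonzerodivisor_mod I l.
Hypothesis genJ : J = adjoin I g.
Hypothesis prJ : irrelevant_primary (adjoin J l).
Hypothesis dual_phi : dualizing_functional (adjoin I (l ^+ N)) d phi.
Hypotheses (dkt : (t + k' = d)%N) (dkt' : (t' + k = d)%N).
Hypotheses (tN : (t + e = k + N)%N) (tN' : (t' + e = k' + N)%N).
Hypotheses (ltkN : (k < N)%N) (ltkN' : (k' < N)%N).
Hypothesis expN : forall p, p \is k.-homog -> (exists M, J (l ^+ M * p)) -> J (l ^+ N * p).
Hypothesis expN' : forall p, p \is k'.-homog -> (exists M, J (l ^+ M * p)) -> J (l ^+ N * p).

Let idJ : is_ideal J := is_ideal_gen _.
Let lN_homog : l ^+ N \is N.-homog.
Proof. by rewrite -[N in N.-homog]mul1n; exact: dhomogMn. Qed.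

(** A class of the local cohomology module is given by a homogeneous [p], and the
    pairing is computed from the [p'] linked to it. *)
Definition represents i j (x : H0m f i) (p p' : P) : Prop :=
  [/\ p \is i.-homog, jacobian_class f p = val x, p' \is j.-homog
    & linked I (l ^+ N) g p p'].

Lemma representative_exists i j (x : H0m f i) : (j + e = i + N)%N ->
  (forall p, p \is i.-homog -> (exists M, J (l ^+ M * p)) -> J (l ^+ N * p)) ->
  exists pp : P * P, represents j x pp.1 pp.2.
Proof.
move=> jN hN; have /asboolP[[p0 /(saturation_pow hl)[M Jp0] cl0] [p hp cl]] := valP x.
have Jp : J (l ^+ N * p).
  apply: hN => //; exists M.
  have -> : l ^+ M * p = l ^+ M * p0 + l ^+ M * (p - p0) by ring.
  by apply: idealD => //; apply: idealM => //; apply/jacobian_class_eq; rewrite cl0 cl.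
rewrite genJ in Jp.
have [|p' hp' Ip'] := graded_adjoin_homog (k := j) grI hg _ Jp.
  by rewrite jN addnC; exact: dhomogM.
by exists (p, p'); split=> //=; rewrite /linked [g * _]mulrC.
Qed.

Lemma represents_linear i j c (x y : H0m f i) p p' q q' :
  represents j x p p' -> represents j y q q' ->
  represents j (c *: x + y) (c *: p + q) (c *: p' + q').
Proof.
move=> [hp cp hp' lp] [hq cq hq' lq]; split; rewrite ?rpredD ?rpredZ //.
  by rewrite jacobian_classD jacobian_classZ cp cq.
rewrite /linked; have -> : l ^+ N * (c *: p + q) - g * (c *: p' + q') =
   c *: (l ^+ N * p - g * p') + (l ^+ N * q - g * q') by rewrite -!mul_mpolyC; ring.
by apply: (idealD grI.1) => //; exact: (idealZ grI.1).
Qed.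

(** The difference of two representatives of one class lies in the gradient ideal,
    which pairs to zero with every linked pair. *)
Lemma represents_well_defined i j i' j' (x : H0m f i) (y : H0m f i') p p' q q' r r' s s' :
  represents j x p p' -> represents j x r r' ->
  represents j' y q q' -> represents j' y s s' -> phi (p' * q) = phi (r' * s).
Proof.
move=> [_ cp _ lp] [_ cr _ lr] [_ cq _ lq] [_ cs _ ls].
have Jpr : adjoin I g (p - r) by rewrite -genJ; apply/jacobian_class_eq; rewrite cp cr.
have Jqs : adjoin I g (q - s) by rewrite -genJ; apply/jacobian_class_eq; rewrite cq cs.
have lpr : linked I (l ^+ N) g (p - r) (p' - r').
  rewrite /linked; have -> : l ^+ N * (p - r) - g * (p' - r') =
     (l ^+ N * p - g * p') - (l ^+ N * r - g * r') by ring.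
  exact: (idealB grI.1).
have nzu := nonzerodivisorX (N := N) nzl.
have -> : p' * q = (p' - r') * q + r' * (q - s) + r' * s by ring.
rewrite !linearD /= (linked_gen_l grI nzu dual_phi lpr lq Jpr).
by rewrite (linked_gen_r grI dual_phi lr Jqs) !add0r.
Qed.

Lemma H0m_of_linked i j p p' : p \is i.-homog -> p' \is j.-homog ->
  linked I (l ^+ N) g p p' -> exists x : H0m f i, represents j x p p'.
Proof.
move=> hp hp' lp.
have px : H0m_pred i (jacobian_class f p).
  apply/asboolP; split; last by exists p.
  exists p => //; apply: pow_saturation prJ _ => //; rewrite genJ.
  by exists p'; rewrite [p' * _]mulrC; exact: lp.
by exists (exist (fun y => H0m_pred i y) (jacobian_class f p) px).
Qed.

Lemma H0m_eq0 i (x : H0m f i) p : jacobian_class f p = val x -> J p -> x = 0.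
Proof.
move=> cp Jp; apply: val_inj; rewrite -cp.
have -> : val (0 : H0m f i) = jacobian_class f 0 by apply: esym; exact: raddf0.
by apply/jacobian_class_eq; rewrite subr0.
Qed.

Lemma H0m_span i : exists m (a : 'I_m -> H0m f i),
  forall x, exists c : 'I_m -> K, x = \sum_j c j *: a j.
Proof.
pose mon (j : 'I_#|{: 'X_{1..n < i.+1}}|) : jacobian_ring f :=
  jacobian_class f (pihomog mdeg i 'X_[(enum_val j : 'X_{1..n < i.+1})]).
have class_sum (T : finType) (c : T -> K) (p : T -> P) :
    jacobian_class f (\sum_j c j *: p j) = \sum_j c j *: jacobian_class f (p j).
  elim/big_rec2: _ => [|j x y _ <-]; first exact: raddf0.
  by rewrite jacobian_classD jacobian_classZ.
have [S0 SZD] := @H0m_pred_closed K n f i.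
have subS : subspace [set x : jacobian_ring f | H0m_pred i x]%classic by split.
have [|b [bS spanb]] := @subspace_span _ _ _ mon _ subS.
  move=> x /= /asboolP[_ [p hp <-]]; have [c ->] := homog_span hp.
  by exists c; rewrite class_sum.
exists _, (fun j => exist (fun y => H0m_pred i y) (b j) (bS j) : H0m f i) => x.
have [c xE] := spanb (val x) (valP x); exists c; apply: val_inj; rewrite xE.
elim/big_rec2: _ => [|j y z _ ->]; first by apply: esym; exact: raddf0.
by [].
Qed.

Lemma linkage_duality : lmod_isomorphic (H0m f k) (dual (H0m f k')).
Proof.
have nzu := nonzerodivisorX (N := N) nzl.
have /choice[P1 hP1] : forall x : H0m f k, exists pp : P * P, represents t x pp.1 pp.2.
  by move=> x; exact: representative_exists.
have /choice[P2 hP2] : forall x : H0m f k', exists pp : P * P, represents t' x pp.1 pp.2.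
  by move=> x; exact: representative_exists.
pose beta x y := phi ((P1 x).2 * (P2 y).1).
have betaE x y p p' q q' : represents t x p p' -> represents t' y q q' ->
    beta x y = phi (p' * q).
  by move=> xp yq; exact: represents_well_defined (hP1 x) xp (hP2 y) yq.
have [m [a spana]] := H0m_span k'.
apply: (perfect_pairing_isomorphic (beta := beta) _ _ spana).
- move=> y c x1 x2; rewrite (betaE _ _ _ _ _ _ (represents_linear c (hP1 x1) (hP1 x2)) (hP2 y)).
  by rewrite mulrDl -scalerAl linearP.
- move=> x c y1 y2; rewrite (betaE _ _ _ _ _ _ (hP1 x) (represents_linear c (hP2 y1) (hP2 y2))).
  by rewrite mulrDr -scalerAr linearP.
- move=> x x0; have [hp cp _ lp] := hP1 x; apply: (H0m_eq0 cp); rewrite genJ.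
  apply: (linked_nondegenerate grI lN_homog hg dual_phi dkt' tN') => // q q' hq hq' lq.
  rewrite (linked_sym grI nzu dual_phi lq lp) mulrC.
  have [y yq] := H0m_of_linked hq hq' lq.
  by rewrite -(betaE _ _ _ _ _ _ (hP1 x) yq) x0.
- move=> y y0; have [hq cq _ lq] := hP2 y; apply: (H0m_eq0 cq); rewrite genJ.
  apply: (linked_nondegenerate grI lN_homog hg dual_phi dkt tN) => // p p' hp hp' lp.
  have [x xp] := H0m_of_linked hp hp' lp.
  by rewrite -(betaE _ _ _ _ _ _ xp (hP2 y)) y0.
Qed.

End LinkagePairing.

(** * A complete intersection inside the gradient ideal *)

Section CompleteIntersection.
Variables (K : closedFieldType) (r : nat).
Hypothesis uncK : uncountable_field K.
Local Notation P := {mpoly K[r.+1]}.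
Local Notation ideal_of s := (adjoin_seq [set 0]%classic (s : seq P)).

(** The linear form is the first variable plus a combination of the others, so the
    ideal is that of the variables. *)
Lemma gorenstein_linear_forms t (s := [seq ('X_(lift ord0 i) : P) | i : 'I_r]) :
  gorenstein_seq (rcons s (horner_comb t ('X_ord0 :: s))) 0.
Proof.
pose js := [seq lift ord0 i | i : 'I_r].
have sE : s = [seq 'X_i | i <- js] by rewrite -map_comp.
have enumE : enum 'I_r.+1 = ord0 :: js by rewrite enum_ordSl.
have := enum_uniq 'I_r.+1; rewrite enumE => /andP[nj uj].
set x0 := 'X_ord0; set l := horner_comb _ _.
have grs : graded_ideal (ideal_of s) by rewrite sE; exact: graded_variable_ideal.
have adj_l : adjoin (ideal_of s) l = variable_ideal (K := K) (enum 'I_r.+1).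
  rewrite enumE /variable_ideal /= adjoin_seq_adjoin -sE.
  apply: adjoin_congr; first exact: grs.1.
  rewrite /l /= addrC addKr; apply: (idealZ grs.1).
  by apply: horner_comb_ideal; exact: (graded_zero_ideal _ _).1.
have in_enum (i : 'I_r.+1) : i \in enum 'I_r.+1 by rewrite mem_enum.
have [soc pr] := variable_ideal_socle K in_enum.
have px0 : positive_form x0.
  by apply: (@variable_positive_form _ _ [:: ord0]); rewrite /= mem_head.
split; rewrite ?adjoin_seq_rcons ?adj_l //; last by exists 1.
apply/regular_rcons; split; first by rewrite sE; exact: regular_variables.
apply: (nonzerodivisor_exchange (x := x0)) => //; first by rewrite adj_l.
by rewrite sE; exact: nonzerodivisor_variable.
Qed.

(** [l] is chosen nonzero on the singular points, so the partials have no common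
    zero on the hyperplane of [l]. The chain of exchanges starts from the variables
    with the first one replaced by [l], and a last exchange of [l] for its power
    gives the dualizing functional. *)
Theorem complete_intersection_linkage e (f : P) : (0 < e)%N ->
  (forall i, f^`M(i) \is e.-homog) ->
  (forall v : 'I_r.+1 -> K, (forall i, (f^`M(i)).@[v] = 0) -> f.@[v] = 0) ->
  isolated_singularities f ->
  exists (I : set P) (l g : P), [/\ graded_ideal I, l \is 1.-homog, g \is e.-homog,
    nonzerodivisor_mod I l & gradient_ideal f = adjoin I g] /\
    irrelevant_primary (adjoin (gradient_ideal f) l) /\
    forall N, (0 < N)%N -> exists phi : {scalar P},
      dualizing_functional (adjoin I (l ^+ N)) (r * e.-1 + N.-1) phi.
Proof.
move=> e0 hf euler isol.
have finS := isolated_finitely_many_lines uncK hf euler isol.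
pose s := [seq ('X_(lift ord0 i) : P) | i : 'I_r].
have hX (i : 'I_r.+1) : ('X_i : P) \is 1.-homog.
  by rewrite dhomogX; apply/eqP; exact: mdeg1.
have hs : all_homog 1 s by move=> x /mapP[i _ ->].
have hxs x : x \in 'X_ord0 :: s -> x \is 1.-homog.
  by rewrite inE => /predU1P[->|/hs].
have [|t ht] := generic_combination finS hxs.
  move=> v [[i vi] _ _]; exists 'X_i; last by rewrite mevalXU.
  rewrite inE; case: (unliftP ord0 i) => [j|] ->; last by rewrite eqxx.
  by apply/orP; right; apply/mapP; exists j; rewrite ?mem_enum.
pose l := horner_comb t ('X_ord0 :: s).
have hl : l \is 1.-homog by exact: horner_comb_homog.
have hparts : all_homog e (partials f) by move=> x /mapP[i _ ->].
have zero_parts v : common_zeros (partials f) v -> forall i, (f^`M(i)).@[v] = 0.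
  by move=> hv i; apply: hv; apply: map_f; rewrite mem_enum.
have noz v : common_zeros (l :: [::] ++ partials f) v -> ~ nonzero_point v.
  move=> hv v0; have grad0 : forall i, (f^`M(i)).@[v] = 0.
    by apply: zero_parts => x xf; apply: hv; rewrite inE xf orbT.
  have /ht/eqP[] : singular_point f v by split; [| exact: euler |].
  by apply: hv; rewrite mem_head.
have szp : size (partials f) = (size s).+1 by rewrite /partials /s !size_image !card_ord.
have gor0 : gorenstein_seq (s ++ [:: l]) 0 by rewrite cats1; exact: gorenstein_linear_forms.
have nil_homog : all_homog e ([::] : seq P) by [].
have [gs [g [hgs hg gor genJ]]] :=
  exchange_chain uncK e0 hl hs nil_homog hparts szp noz gor0.
have pgs x : x \in gs -> positive_form x by move=> /hgs hx; exists e.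
have grI : graded_ideal (ideal_of gs).
  by apply: graded_adjoin_seq pgs; exact: graded_zero_ideal.
have [regl prl _] := gor.
exists (ideal_of gs), l, g; split; first split=> //.
- suff /regular_rcons[_] : regular [set 0]%classic (rcons gs l) by [].
  apply: regular_rot regl; first exact: graded_zero_ideal.
  by move=> y; rewrite inE => /predU1P[->|/pgs//]; exists 1%N.
- by rewrite gradient_ideal_partials -[partials f]cat0s genJ adjoin_seq_rcons.
split=> [|N N0].
  apply: projective_nullstellensatz => // [|v hv i].
    apply: graded_adjoin hl; apply: graded_ideal_gen => x [i _ <-]; by exists e.
  apply/eqP; apply: contraT => vi; case: (noz v); last by exists i.
  move=> x; rewrite inE => /predU1P[->|/mapP[j _ ->]].
    by apply: hv; apply: mem_adjoin; exact: is_ideal_gen.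
  by apply/hv/sub_adjoin/mem_ideal_gen; exists j.
have hlN : l ^+ N \is N.-homog by rewrite -[N in N.-homog]mul1n; exact: dhomogMn.
rewrite /= adjoin_seq_adjoin in prl.
have prN := primary_adjoin_pow N grI.1 prl.
have [|_ _ [w socw]] := gorenstein_exchange N0 pgs hl hlN _ gor.
  by rewrite /= adjoin_seq_adjoin.
rewrite adjoin_seq_rcons add0n /s size_image card_ord in socw.
by apply: socle_functional prN socw; exact: graded_adjoin hlN.
Qed.

End CompleteIntersection.

Theorem theorem3p4 (R : realType) (r d : nat) (f : {mpoly R[i][r.+1]}) :
  (2 <= r)%N ->
  f \is d.-homog ->
  reduced_poly f ->
  isolated_singularities f ->
  forall k : nat, k%:Z <= sigma r d ->
    lmod_isomorphic (H0m f k) (dual (H0m f `|sigma r d - k%:Z|%N)).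
Proof.
move=> _ hf _ isol k lek.
have le2d : (2 <= d)%N.
  rewrite leqNgt; apply/negP => ltd2; move: lek; rewrite /sigma.
  by have : d%:Z - 2 < 0 by [lia]; nia.
have sigmaE : sigma r d = (r.+1 * (d - 2))%N by rewrite /sigma PoszM -subzn.
rewrite sigmaE in lek *; set sg := (r.+1 * (d - 2))%N in sigmaE lek *.
have sgE : sg = (d - 2 + r * d.-1.-1)%N by rewrite /sg mulSn -!subn1 -subnDA.
clearbody sg; have lek' : (k <= sg)%N by lia.
have -> : `|sg%:Z - k%:Z|%N = (sg - k)%N by lia.
have e0 : (0 < d.-1)%N by lia.
have hpart i : f^`M(i) \is d.-1.-homog by exact: mderiv_homog.
have euler (v : 'I_r.+1 -> R[i]) : (forall i, (f^`M(i)).@[v] = 0) -> f.@[v] = 0.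
  move=> grad0; have /(congr1 (meval v)) := euler_identity hf.
  rewrite mevalZ rmorph_sum big1 => [/esym/eqP|i _]; last by rewrite /= mevalM grad0 mulr0.
  by rewrite mulf_eq0 pnatr_eq0; case: eqP => [d0|_ /eqP //]; move: le2d; rewrite d0.
have [I [l [g [[grI hl hg nzl genJ] [prJ hphi]]]]] :=
  complete_intersection_linkage (@complex_uncountable R) e0 hpart euler isol.
have idJ := is_ideal_gen (range (fun i => f^`M(i))).
have [N1 hN1] := uniform_exponent l k idJ.
have [N2 hN2] := uniform_exponent l (sg - k)%N idJ.
pose N := (d + sg + N1 + N2).+1.
have expJ M p : (M <= N)%N -> gradient_ideal f (l ^+ M * p) -> gradient_ideal f (l ^+ N * p).
  by move=> leMN Jp; rewrite -(subnK leMN) exprD -mulrA; exact: idealM.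
have [phi dphi] := hphi N (ltn0Sn _).
apply: (linkage_duality (t := (N + k - d.-1)%N) (t' := (N + (sg - k) - d.-1)%N)
  grI hl hg nzl genJ prJ dphi); rewrite ?/N; try lia.
- by move=> p hp [M Jp]; apply: (expJ N1); [rewrite /N; lia | apply: hN1 => //; exists M].
- by move=> p hp [M Jp]; apply: (expJ N2); [rewrite /N; lia | apply: hN2 => //; exists M].
Qed.
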